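(* Let $w=\{w_n\}_{n=0}^\infty$ be a sequence of complex numbers with $w_0=0$, and let $1\le p<\infty$. The following hold. (i) Let $\phi$ be a normal weight and let $$\tilde M(r):=\sum_{n\ge1}|w_n|\Big(\int_0^1R^{np+1}\phi(R)\,dR\Big)^{-1/p}r^n.$$ If there exist constants $C_1>0$ and $-\infty<t<1/p$ such that $$\phi(r)^{1/p}\tilde M(r)\le\frac{C_1}{(1-r)^t}$$ for all $0<r<1$, then $M_w$ is a bounded operator on $A^p_\phi$. (ii) Let $\alpha>-1$. If there are constants $C_2>0$ and $-\infty<s<\frac{\alpha+1}{p}$ such that $$\sum_{n\ge1}|w_n|(n+1)^{\frac{\alpha+1}{p}}r^n\le\frac{C_2}{(1-r)^s}$$ for all $0<r<1$, then $M_w$ is bounded on $A^p_\alpha$. (iii) Let $a>b>0$. If there are constants $C_3>0$ and $-\infty<u<\frac{a+1-b}{p}$ such that $$\sum_{n\ge1}|w_n|\frac{(n+1)^{\frac{a+1}{p}}}{(\log(n+1))^{\frac bp}}r^n\le\frac{C_3}{(1-r)^u}$$ for all $0<r<1$, then $M_w$ is bounded on $A^p_{a,b}$.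
   Context: $\mathbb{D}$ is the open unit disc in $\mathbb{C}$ and $dA=\frac1\pi dx\,dy$. A weight is a strictly positive function $\phi$ on $\mathbb{D}$ integrable with respect to $dA$; it is radial if $\phi(z)=\phi(|z|)$. A continuous radial weight $\phi(r)$, $r\in[0,1)$, is called normal if there are constants $k>\epsilon>-1$ and $0<r_0<1$ such that, for $r_0\le r<1$ and as $r\to1^-$, $\phi(r)/(1-r)^\epsilon$ decreases to $0$ and $\phi(r)/(1-r)^k$ increases to $\infty$. $A^p_\phi$ is the space of analytic $f$ on $\mathbb{D}$ with $\|f\|^p_{A^p_\phi}=\int_{\mathbb{D}}|f|^p\phi\,dA<\infty$. $A^p_\alpha$ is the case $\phi(z)=(1+\alpha)(1-|z|^2)^\alpha$ ($\alpha>-1$), and $A^p_{a,b}$ is the case $\phi(z)=(1-|z|)^a\big(\log\frac{e}{1-|z|}\big)^b$ ($a>b>0$). $M_w$ is the coefficient multiplier $M_w\big(\sum_{n\ge0}\lambda_nz^n\big)=\sum_{n\ge0}w_n\lambda_nz^n$, with the convention $w_0=0$. *)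

(* Defs.v *)
From HB Require Import structures.
From mathcomp Require Import all_boot all_order all_algebra complex.
From mathcomp Require Import all_classical all_reals all_analysis measurable_realfun.

Set Implicit Arguments.
Unset Strict Implicit.
Unset Printing Implicit Defensive.

Import Order.TTheory GRing.Theory Num.Theory.
Import numFieldNormedType.Exports.

Local Open Scope classical_set_scope.
Local Open Scope complex_scope.
Local Open Scope ring_scope.

(* [R[i]] packed as a [numClosedFieldType]: this is what makes the canonical
   topology of MathComp-Analysis (given by the modulus) available on it. *)
Definition cplx (R : realType) : numClosedFieldType := R[i].

(* The library norm [`|z|] is [R[i]]-valued; [cabs] is the real modulus. *)
Definition cabs (R : realType) (z : cplx R) : R := ComplexField.Normc.normc z.

Definition unit_disc (R : realType) : set (cplx R) := [set z | cabs z < 1].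

(* The plane as the measurable space [R * R]; [R[i]] itself carries no
   measurable structure in the library. *)
Definition of_plane (R : realType) (u : R * R) : cplx R := u.1 +i* u.2.

Definition plane_disc (R : realType) : set (R * R) :=
  @of_plane R @^-1` @unit_disc R.

Lemma invpi_ge0 (R : realType) : 0 <= (pi : R)^-1.
Proof. by rewrite invr_ge0 pi_ge0. Qed.

Definition dA (R : realType) :
    {measure set (measurableTypeR R * measurableTypeR R) -> \bar R} :=
  mscale (NngNum (invpi_ge0 R))
    (@lebesgue_measure R \x @lebesgue_measure R)%E.

Definition has_power_series (R : realType) (z0 : cplx R) (rho : R)
    (c : nat -> cplx R) (f : cplx R -> cplx R) : Prop :=
  forall z : cplx R, cabs (z - z0) < rho ->
    series (fun n => c n * (z - z0) ^+ n) @ \oo --> f z.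

Definition analytic_on_disc (R : realType) (f : cplx R -> cplx R) : Prop :=
  forall z0 : cplx R, unit_disc z0 ->
    exists (c : nat -> cplx R) (rho : R), 0 < rho /\ has_power_series z0 rho c f.

Definition weight (R : realType) (phi : cplx R -> R) : Prop :=
  (forall z, unit_disc z -> 0 < phi z) /\
  (@dA R).-integrable (@plane_disc R) (fun u => (phi (of_plane u))%:E).

Definition radial (R : realType) (phi : cplx R -> R) : Prop :=
  forall z, unit_disc z -> phi z = phi (cabs z)%:C.

(* The profile [r |-> phi(r)], [0 <= r < 1], of a radial weight. *)
Definition profile (R : realType) (phi : cplx R -> R) (r : R) : R := phi r%:C.

(* "Decreases" and "increases" are understood in the weak sense. *)
Definition normal_weight (R : realType) (phi : cplx R -> R) : Prop :=
  [/\ weight phi, radial phi,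
      {within `[0, 1[%classic, continuous (profile phi)} &
      exists k eps r0 : R,
      [/\ -1 < eps, eps < k, 0 < r0 < 1,
          (forall r s, r0 <= r -> r <= s -> s < 1 ->
             profile phi s / (1 - s) `^ eps <= profile phi r / (1 - r) `^ eps) /\
          (profile phi r / (1 - r) `^ eps @[r --> 1^'-] --> (0 : R)) &
          (forall r s, r0 <= r -> r <= s -> s < 1 ->
             profile phi r / (1 - r) `^ k <= profile phi s / (1 - s) `^ k) /\
          (profile phi r / (1 - r) `^ k @[r --> 1^'-] --> +oo)]].

(* The [p]-th power of the norm of [A^p_phi], possibly infinite. *)
Definition bergman_integral (R : realType) (p : R) (phi : cplx R -> R)
    (f : cplx R -> cplx R) : \bar R :=
  (\int[@dA R]_(u in @plane_disc R)
     (cabs (f (of_plane u)) `^ p * phi (of_plane u))%:E)%E.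

Definition bergman (R : realType) (p : R) (phi : cplx R -> R) :
    set (cplx R -> cplx R) :=
  [set f | analytic_on_disc f /\ (bergman_integral p phi f < +oo)%E].

Definition bergman_norm (R : realType) (p : R) (phi : cplx R -> R)
    (f : cplx R -> cplx R) : R :=
  fine (bergman_integral p phi f) `^ p^-1.

(* [multiplier_graph w f g] reads "[M_w f = g] on the disc": the series with
   coefficients [w n * lambda n] is required to converge to [g] there. *)
Definition multiplier_graph (R : realType) (w : nat -> cplx R)
    (f g : cplx R -> cplx R) : Prop :=
  exists lambda : nat -> cplx R,
    has_power_series 0 1 lambda f /\
    has_power_series 0 1 (fun n => w n * lambda n) g.

Definition multiplier_bounded (R : realType) (w : nat -> cplx R) (p : R)
    (phi : cplx R -> R) : Prop :=
  exists K : R, forall f, bergman p phi f ->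
    exists g, [/\ multiplier_graph w f g, bergman p phi g &
                  bergman_norm p phi g <= K * bergman_norm p phi f].

Definition standard_weight (R : realType) (alpha : R) (z : cplx R) : R :=
  (1 + alpha) * (1 - cabs z ^+ 2) `^ alpha.

Definition log_weight (R : realType) (a b : R) (z : cplx R) : R :=
  (1 - cabs z) `^ a * (ln (expR 1 / (1 - cabs z))) `^ b.

Definition moment (R : realType) (p : R) (phi : cplx R -> R) (n : nat) : R :=
  \int[@lebesgue_measure R]_(s in `[0, 1[%classic)
     (s `^ (n%:R * p + 1) * profile phi s).

(* Sums of nonnegative terms are taken in [\bar R], so that divergence is
   [+oo] and a finite upper bound entails convergence. *)
Definition Mtilde (R : realType) (p : R) (phi : cplx R -> R)
    (w : nat -> cplx R) (r : R) : \bar R :=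
  (\sum_(1 <= n <oo)
     (cabs (w n) * moment p phi n `^ (- p^-1) * r ^+ n)%:E)%E.

(* Main.v *)
Require Import Defs.
From HB Require Import structures.
From mathcomp Require Import all_boot all_order all_algebra complex.
From mathcomp Require Import all_classical all_reals all_analysis measurable_realfun.
From mathcomp Require Import cyclic separable cyclotomic lra ring zify.
Import Order.TTheory GRing.Theory Num.Theory.
Import numFieldNormedType.Exports.
Local Open Scope classical_set_scope.
Local Open Scope complex_scope.
Local Open Scope ring_scope.

Set Implicit Arguments.
Unset Strict Implicit.
Unset Printing Implicit Defensive.

(* The coefficients of f in A^p_phi satisfy |lambda_n|^p * moment n <= C ||f||^p:
   averaging f over the rotations by N-th roots of unity isolates the monomial
   lambda_n z^n as N tends to infinity, and Fatou's lemma, convexity and the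
   rotation invariance of the area measure compare its integral with that of f.
   Hence |M_w f(z)| <= C ||f|| sum_n |w_n| (moment n)^(-1/p) |z|^n, and the
   hypothesis gives |M_w f|^p phi <= C ||f||^p (1 - |z|)^(-q) with q < 1, which
   is integrable on the disc.  For the two special weights the moments are
   bounded below by restricting them to [1 - 1/(n+1), 1 - 1/(2(n+1))].

   That a function which is locally a power series is the sum of its Taylor
   series at 0 on the whole disc is proved without contour integrals: Cauchy
   estimates for re-expanded series, uniform by compactness, push the radius of
   the series at 0 past any r < 1 by steps of fixed length. *)

(** * Complex series *)

(* Otherwise [/=] turns every modulus into a square root. *)
Arguments cabs : simpl never.

(** All three statements come from one criterion, in which a sequence [kappa] stands for the moments
    to the power [-1/p] up to a constant. In (i) the hypothesis is used as it is. In (ii) and (iii)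
    it does not contain the weight, whose own size is therefore moved into the exponent: [phi^(1/p)]
    is at most a constant times [(1 - r)^(alpha/p)], respectively [(1 - r)^((a - b)/p)], the loss of
    [b] coming from [log(e/x) <= 1/x]. The ranges allowed for [s] and [u] say exactly that the
    resulting exponent [t] is below [1/p], and [q] is [t * p]. Averages over roots of unity serve
    twice: on a circle they give Cauchy's estimates, under the area integral they give the
    coefficient bound. Being finite sums, they only require invariance under one rotation at a time,
    and their error is a tail of an absolutely convergent series. A rotation is in turn a product of
    shears, each handled by Tonelli. Polar coordinates are established up to an unspecified positive
    factor, which is enough for boundedness. *)

Section cabs_theory.
Context {R : realType}.
Implicit Types z : cplx R.

Lemma cabsE z : `|z| = (cabs z)%:C.
Proof. by []. Qed.

Lemma cabs_ge0 z : 0 <= cabs z.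
Proof. by rewrite /cabs; case: z => a b /=; rewrite sqrtr_ge0. Qed.

Lemma cabs0 : cabs (0 : cplx R) = 0.
Proof. exact: ComplexField.Normc.normc0. Qed.

Lemma cabs1 : cabs (1 : cplx R) = 1.
Proof. exact: ComplexField.Normc.normc1. Qed.

Lemma cabsM z1 z2 : cabs (z1 * z2) = cabs z1 * cabs z2.
Proof. exact: ComplexField.Normc.normcM. Qed.

Lemma cabsX z n : cabs (z ^+ n) = cabs z ^+ n.
Proof. by elim: n => [|n IH]; rewrite ?expr0 ?cabs1// !exprS cabsM IH. Qed.

Lemma cabsD z1 z2 : cabs (z1 + z2) <= cabs z1 + cabs z2.
Proof. exact: le_normcD. Qed.

Lemma cabsN z : cabs (- z) = cabs z.
Proof. exact: normcN. Qed.

Lemma cabsB z1 z2 : cabs (z1 - z2) = cabs (z2 - z1).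
Proof. by rewrite -opprB cabsN. Qed.

Lemma cabs_dist z1 z2 : `|cabs z1 - cabs z2| <= cabs (z1 - z2).
Proof.
have H (x y : cplx R) : cabs x - cabs y <= cabs (x - y).
  by rewrite lerBlDr -{1}(subrK y x); exact: cabsD.
by rewrite ler_norml lerNl opprB cabsB H/= cabsB H.
Qed.

Lemma cabs_eq0 z : cabs z = 0 -> z = 0.
Proof. exact: ComplexField.Normc.eq0_normc. Qed.

Lemma cabsR (x : R) : cabs (x%:C : cplx R) = `|x|.
Proof. by rewrite /cabs /= expr0n addr0 sqrtr_sqr. Qed.

Lemma cabs_nat n : cabs (n%:R : cplx R) = n%:R.
Proof.
suff -> : (n%:R : cplx R) = (n%:R : R)%:C by rewrite cabsR ger0_norm.
by rewrite rmorph_nat.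
Qed.

Lemma cabsV z : cabs z^-1 = (cabs z)^-1.
Proof. exact: ComplexField.Normc.normcV. Qed.

Lemma cabs_sum (I : Type) (s : seq I) (P : pred I) (F : I -> cplx R) :
  cabs (\sum_(i <- s | P i) F i) <= \sum_(i <- s | P i) cabs (F i).
Proof.
elim/big_ind2 : _ => //; first by rewrite cabs0.
by move=> x1 x2 y1 y2 h1 h2; rewrite (le_trans (cabsD _ _))// lerD.
Qed.

Lemma normRe_cabs z : `|complex.Re z| <= cabs z.
Proof.
case: z => a b; rewrite /cabs /= -[leLHS]sqrtr_sqr ler_wsqrtr//.
by rewrite lerDl sqr_ge0.
Qed.

Lemma normIm_cabs z : `|complex.Im z| <= cabs z.
Proof.
case: z => a b; rewrite /cabs /= -[leLHS]sqrtr_sqr ler_wsqrtr//.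
by rewrite lerDr sqr_ge0.
Qed.

Lemma cabs_ReIm z : cabs z <= `|complex.Re z| + `|complex.Im z|.
Proof.
case: z => a b; rewrite /cabs /= -[leRHS]ger0_norm ?addr_ge0//.
rewrite -sqrtr_sqr ler_wsqrtr// sqrrD !real_normK ?num_real//.
by rewrite -addrA lerD2l lerDr mulrn_wge0// mulr_ge0.
Qed.

(** A positive element of [R[i]] is a positive real, so the radii that define the topology of the
    plane are real and complex limits reduce to real limits of moduli. *)
Lemma cvg_cabsP (u : nat -> cplx R) (l : cplx R) :
  u @ \oo --> l <-> cabs (u n - l) @[n --> \oo] --> (0 : R).
Proof.
split.
- move=> /cvgrPdist_lt h; apply/cvgrPdist_lt => e e0.
  have e0' : (0 : cplx R) < e%:C by rewrite ltcR.
  have := h _ e0'; apply: filterS => n.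
  by rewrite cabsE ltcR sub0r normrN ger0_norm ?cabs_ge0// cabsB.
- move=> /cvgrPdist_lt h; apply/cvgrPdist_lt => e e0.
  have [e1 e2] : complex.Im e = 0 /\ 0 < complex.Re e.
    by move: e0; rewrite ltcE /= => /andP[/eqP -> ->].
  have := h _ e2; apply: filterS => n.
  rewrite sub0r normrN ger0_norm ?cabs_ge0// cabsB cabsE.
  by rewrite ltcE /= e1 eqxx.
Qed.

Lemma ccvg_unique (u : nat -> cplx R) (l l' : cplx R) :
  u @ \oo --> l -> u @ \oo --> l' -> l = l'.
Proof.
move=> /cvg_cabsP h /cvg_cabsP h'; apply/eqP; rewrite -subr_eq0; apply/eqP.
apply: cabs_eq0; apply/eqP; rewrite eq_le cabs_ge0 andbT.
have : (cabs (u n - l) + cabs (u n - l')) @[n --> \oo] --> (0 + 0 : R) by exact: cvgD.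
rewrite addr0 => /cvgr_to_ge; apply; apply: nearW => n /=.
have -> : l - l' = - (u n - l) + (u n - l') by rewrite opprB addrA subrK.
by rewrite (le_trans (cabsD _ _))// cabsN.
Qed.

Lemma cvg_cabs (u : nat -> cplx R) (l : cplx R) :
  u @ \oo --> l -> cabs (u n) @[n --> \oo] --> cabs l.
Proof.
move=> /cvg_cabsP h; apply/cvgrPdist_lt => e e0.
move/cvgrPdist_lt : h => /(_ _ e0); apply: filterS => n.
rewrite sub0r normrN ger0_norm ?cabs_ge0//; apply: le_lt_trans.
by rewrite distrC cabs_dist.
Qed.

Lemma ccvgB (u v : nat -> cplx R) (l l' : cplx R) :
  u @ \oo --> l -> v @ \oo --> l' -> (u n - v n) @[n --> \oo] --> l - l'.
Proof. by move=> ul vl; exact: (@cvgB _ (cplx R) _ _ _ u v _ _ ul vl). Qed.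

Lemma ccvgMr (u : nat -> cplx R) (l a : cplx R) :
  u @ \oo --> l -> (u n * a) @[n --> \oo] --> l * a.
Proof.
move=> /cvg_cabsP ul; apply/cvg_cabsP.
have : (cabs (u n - l) * cabs a) @[n --> \oo] --> 0 * cabs a.
  by apply: cvgM => //; exact: cvg_cst.
by rewrite mul0r; under eq_fun do rewrite -cabsM mulrBl.
Qed.

Lemma ccvg_sum (M : nat) (u : nat -> nat -> cplx R) (l : nat -> cplx R) :
  (forall m, u m @ \oo --> l m) ->
  (\sum_(0 <= m < M) u m n) @[n --> \oo] --> \sum_(0 <= m < M) l m.
Proof.
move=> ul; elim: M => [|M IH].
  by rewrite big_geq//; under eq_fun do rewrite big_geq//; exact: cvg_cst.
rewrite (@big_nat_recr _ _ _ M 0%N _ (leq0n M)).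
under eq_fun do rewrite (@big_nat_recr _ _ _ M 0%N _ (leq0n M)).
exact: (@cvgD _ (cplx R) _ _ _ _ _ _ _ IH (ul M)).
Qed.

End cabs_theory.

(** * Summability through bounded partial sums *)

Section bounded_sums.
Context {R : realType}.

(** For nonnegative terms this is summability, in a form that passes through comparison and scaling
    without any limit. *)
Definition bsum (a : nat -> R) := exists M, forall n, \sum_(0 <= k < n) a k <= M.

Lemma bsum_le (a b : nat -> R) : (forall k, a k <= b k) -> bsum b -> bsum a.
Proof.
by move=> ab [M h]; exists M => n; rewrite (le_trans _ (h n))// ler_sum.
Qed.

Lemma bsum_scale (c : R) (a : nat -> R) : 0 <= c -> bsum a -> bsum (fun k => c * a k).
Proof.
move=> c0 [M h]; exists (c * M) => n.
by rewrite -mulr_sumr ler_wpM2l.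
Qed.

Lemma bsum_cvg (a : nat -> R) : (forall k, 0 <= a k) -> bsum a -> cvgn (series a).
Proof.
move=> a0 [M h]; apply: nondecreasing_is_cvgn.
  by apply: nondecreasing_series => n _ _; exact: a0.
by exists M => _ [n _ <-]; rewrite /series /= h.
Qed.

(** [T m] is the remainder of the sum. As it does not depend on the upper end [n], the bound
    survives the limit in [n]. *)
Lemma bsum_tail (a : nat -> R) : (forall k, 0 <= a k) -> bsum a ->
  exists T : nat -> R, T @ \oo --> (0 : R) /\
    forall m n, \sum_(m <= k < n) a k <= T m.
Proof.
move=> a0 ba; have ca := bsum_cvg a0 ba.
exists (fun m => limn (series a) - series a m); split.
  rewrite -(subrr (limn (series a))); apply: cvgB => //; exact: cvg_cst.
move=> m n.
have le_n k : series a k <= limn (series a).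
  apply: nondecreasing_cvgn_le => //.
  by apply: nondecreasing_series => j _ _; exact: a0.
have [mn|nm] := leqP m n; last first.
  by rewrite big_geq ?(ltnW nm)// subr_ge0.
by rewrite lerBrDl /series /= -big_cat_nat//; exact: le_n.
Qed.

Lemma cseries_cvg (u : nat -> cplx R) : bsum (fun k => cabs (u k)) ->
  exists l : cplx R, series u @ \oo --> l.
Proof.
move=> bu.
have cp (p : cplx R -> R) : (forall z, `|p z| <= cabs z) -> cvgn (series (p \o u)).
  move=> pc; apply: normed_cvg; apply: bsum_cvg => //.
  - by move=> k; exact: normr_ge0.
  - by apply: (bsum_le _ bu) => k; exact: pc.
have cr := cp (@complex.Re R) normRe_cabs; have ci := cp (@complex.Im R) normIm_cabs.
exists (limn (series (@complex.Re R \o u)) +i* limn (series (@complex.Im R \o u))).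
apply/cvg_cabsP; apply: (@squeeze_cvgr _ _ _ _ (fun=> 0)
  (fun n => `|series (@complex.Re R \o u) n - limn (series (@complex.Re R \o u))| +
   `|series (@complex.Im R \o u) n - limn (series (@complex.Im R \o u))|)).
- apply: nearW => n; rewrite cabs_ge0/= (le_trans (cabs_ReIm _))//.
  have sR : complex.Re (series u n) = series (@complex.Re R \o u) n.
    by rewrite /series /= (big_morph (@complex.Re R) (id1 := 0) (op1 := +%R))// => -[? ?] [? ?].
  have sI : complex.Im (series u n) = series (@complex.Im R \o u) n.
    by rewrite /series /= (big_morph (@complex.Im R) (id1 := 0) (op1 := +%R))// => -[? ?] [? ?].
  by move: sR sI; case: (series u n) => a b /= -> ->.
- exact: cvg_cst.
- rewrite -[X in _ --> X](addr0 0) -[X in _ --> X + _](normr0 R).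
  rewrite -[X in _ --> _ + X](normr0 R); apply: cvgD.
    by apply: cvg_norm; apply/subr_cvg0.
  by apply: cvg_norm; apply/subr_cvg0.
Qed.

Lemma cseries_tail (u : nat -> cplx R) (l : cplx R) (m : nat) (t : R) :
  series u @ \oo --> l -> (forall n, \sum_(m <= k < n) cabs (u k) <= t) ->
  cabs (l - series u m) <= t.
Proof.
move=> ul h.
have : cabs (series u n - series u m) @[n --> \oo] --> cabs (l - series u m).
  apply: cvg_cabs; apply: (ccvgB ul).
  exact: cvg_cst.
move=> /cvgr_to_le; apply; exists m => // n /= mn.
rewrite /series /= (big_cat_nat _ mn)//= [_ + _ - _]addrC addrA addNr add0r.
exact: le_trans (cabs_sum _ _ _) (h n).
Qed.

Lemma cabs_series_le (u : nat -> cplx R) (l : cplx R) (t : R) :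
  series u @ \oo --> l -> (forall n, \sum_(0 <= k < n) cabs (u k) <= t) ->
  cabs l <= t.
Proof.
move=> ul h; have := @cseries_tail u l 0%N t ul h.
by rewrite /series /= big_geq// subr0.
Qed.

Lemma bsum_geo (M q : R) : 0 <= M -> 0 <= q < 1 -> bsum (fun k => M * q ^+ k).
Proof.
move=> M0 /andP[q0 q1]; apply: bsum_scale => //.
exists (1 - q)^-1 => n.
rewrite -(ler_pM2l (x := 1 - q)) ?subr_gt0// mulfV ?gt_eqF ?subr_gt0//.
rewrite -opprB mulNr big_mkord -subrX1 opprB.
by rewrite lerBlDr lerDl exprn_ge0.
Qed.

(** Abel's lemma: terms bounded at radius [r] are dominated at [s < r] by a geometric series of
    ratio [s / r]. *)
Lemma bsum_pow_lt (a : nat -> R) (M r s : R) : (forall k, 0 <= a k) ->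
  (forall k, a k * r ^+ k <= M) -> 0 <= s < r -> bsum (fun k => a k * s ^+ k).
Proof.
move=> a0 aM /andP[s0 sr]; have r0 := le_lt_trans s0 sr.
have M0 : 0 <= M by rewrite (le_trans _ (aM 0%N))// mulr_ge0// exprn_ge0// ltW.
apply: (@bsum_le _ (fun k => M * (s / r) ^+ k)) => [k|].
  by rewrite expr_div_n mulrA [leRHS]mulrAC ler_wpM2r ?exprn_ge0// ler_pdivlMr ?exprn_gt0.
by apply: bsum_geo => //; rewrite divr_ge0 ?(ltW r0)//= ltr_pdivrMr// mul1r.
Qed.

End bounded_sums.

(** * Power series *)

Section power_series.
Context {R : realType}.
Implicit Types (c : nat -> cplx R) (z h : cplx R).

Lemma cvgn_bounded_cabs (u : nat -> cplx R) (l : cplx R) : u @ \oo --> l ->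
  exists M, forall n, cabs (u n) <= M.
Proof.
move=> /cvg_cabs uc; have /cvg_seq_bounded[M [_ hM]] := cvgP _ uc.
exists (M + 1) => n; have := hM (M + 1) (ltr_pwDr ltr01 (lexx _)) n I.
by rewrite /= ger0_norm ?cabs_ge0.
Qed.

(** Convergence at one point at distance [r] from [z0], with [s < r < rho], bounds the terms there;
    Abel's lemma then gives absolute convergence at radius [s]. *)
Lemma power_series_bsum z0 (rho s : R) c f : has_power_series z0 rho c f ->
  0 <= s < rho -> bsum (fun k => cabs (c k) * s ^+ k).
Proof.
move=> hf /andP[s0 sr]; pose r := (s + rho) / 2.
have sr' : s < r by rewrite /r; lra.
have rr : r < rho by rewrite /r; lra.
have r0 : 0 <= r by rewrite (le_trans s0)// ltW.
have hz : cabs (z0 + r%:C - z0) < rho.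
  by rewrite addrAC subrr add0r cabsR ger0_norm.
have /cvgP/cvg_series_cvg_0/cvgn_bounded_cabs[M hM] := hf _ hz.
apply: (@bsum_pow_lt _ _ M r) => //.
- by move=> k; exact: cabs_ge0.
- move=> k; have := hM k.
  by rewrite /= addrAC subrr add0r cabsM cabsX cabsR ger0_norm.
- by rewrite s0 sr'.
Qed.

(** The range of [m] is independent of [k], since the extra binomial coefficients vanish. Double
    sums in [k] and [m] can then be exchanged over rectangles. *)
Lemma binomial_sum (K : comNzRingType) (x y : K) (k M : nat) : (k < M)%N ->
  \sum_(0 <= m < M) 'C(k, m)%:R * x ^+ (k - m) * y ^+ m = (x + y) ^+ k.
Proof.
move=> kM; rewrite exprDn (big_cat_nat _ (n := k.+1))//= [X in _ + X]big1_seq ?addr0.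
  rewrite big_mkord; apply: eq_bigr => i _.
  by rewrite -mulrA mulr_natl.
by move=> i /=; rewrite mem_index_iota => /andP[ki _]; rewrite bin_small// !mul0r.
Qed.

Lemma binomial_sum_le (x y : R) (k M : nat) : 0 <= x -> 0 <= y ->
  \sum_(0 <= m < M) 'C(k, m)%:R * x ^+ (k - m) * y ^+ m <= (x + y) ^+ k.
Proof.
move=> x0 y0; rewrite -(@binomial_sum _ x y k (M + k.+1)) ?leq_addl//.
rewrite [leRHS](big_cat_nat _ (n := M)) ?leq_addr//= lerDl sumr_ge0// => i _.
by rewrite !mulr_ge0// exprn_ge0.
Qed.

Lemma binomial_term_le (x y : R) (k m : nat) : 0 <= x -> 0 <= y ->
  'C(k, m)%:R * x ^+ (k - m) * y ^+ m <= (x + y) ^+ k.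
Proof.
move=> x0 y0; apply: le_trans (binomial_sum_le k m.+1 x0 y0).
rewrite big_nat_recr//= lerDr sumr_ge0// => i _.
by rewrite !mulr_ge0// exprn_ge0.
Qed.

(* The [k]-th term of the series for the [m]-th Taylor coefficient, at [h], of
   [sum_k c k * X ^ k]; it vanishes for [k < m] because ['C(k, m)] does. *)
Definition taylor_term c h (m k : nat) : cplx R :=
  'C(k, m)%:R * c k * h ^+ (k - m).

(** A single term of the binomial expansion of [(cabs h + t) ^+ k] is at most [s ^+ k]. The bound
    [M] is thus inherited by all [m] and all [h] with [cabs h + t <= s], which makes the later
    estimates uniform. *)
Lemma taylor_term_sum_le c h (s t M : R) (m n : nat) :
  (forall n, \sum_(0 <= k < n) cabs (c k) * s ^+ k <= M) ->
  0 <= t -> cabs h + t <= s ->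
  \sum_(0 <= k < n) cabs (taylor_term c h m k) * t ^+ m <= M.
Proof.
move=> hM t0 hts; apply: le_trans (hM n).
apply: ler_sum => k _; rewrite /taylor_term !cabsM cabs_nat cabsX.
rewrite [_ * cabs (c k)]mulrC -2!mulrA ler_wpM2l ?cabs_ge0// mulrA.
apply: le_trans (binomial_term_le _ _ _ t0) _; first exact: cabs_ge0.
by rewrite lerXn2r// nnegrE ?addr_ge0 ?cabs_ge0// (le_trans _ hts)// addr_ge0 ?cabs_ge0.
Qed.

Lemma taylor_term_bsum c h (s : R) m :
  bsum (fun k => cabs (c k) * s ^+ k) -> cabs h < s ->
  bsum (fun k => cabs (taylor_term c h m k)).
Proof.
move=> [M hM] hs; have t0 : 0 < s - cabs h by rewrite subr_gt0.
exists (M / (s - cabs h) ^+ m) => n.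
rewrite ler_pdivlMr ?exprn_gt0// mulr_suml.
by apply: (taylor_term_sum_le _ _ hM (ltW t0)); rewrite addrC subrK.
Qed.

Lemma taylor_coef_exists c h (s : R) :
  bsum (fun k => cabs (c k) * s ^+ k) -> cabs h < s ->
  exists B : nat -> cplx R, forall m, series (taylor_term c h m) @ \oo --> B m.
Proof.
move=> bs hs.
suff /choice[B hB] : forall m, exists l : cplx R, series (taylor_term c h m) @ \oo --> l.
  by exists B.
by move=> m; apply: cseries_cvg; exact: taylor_term_bsum bs hs.
Qed.

(** Both [L] and the [M]-th partial sum of the new series lie within the tail [T M] of the [M]-th
    partial sum of the old one. *)
Lemma taylor_reexpansion c h1 h2 (s : R) (L : cplx R) (B : nat -> cplx R) :
  bsum (fun k => cabs (c k) * s ^+ k) -> cabs h1 + cabs h2 <= s ->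
  series (fun k => c k * (h1 + h2) ^+ k) @ \oo --> L ->
  (forall m, series (taylor_term c h1 m) @ \oo --> B m) ->
  series (fun m => B m * h2 ^+ m) @ \oo --> L.
Proof.
move=> bs hs cL cB.
have s0 : 0 <= s by rewrite (le_trans _ hs)// addr_ge0 ?cabs_ge0.
have a0 k : 0 <= cabs (c k) * s ^+ k by rewrite mulr_ge0 ?cabs_ge0 ?exprn_ge0.
have [T [T0 hT]] := bsum_tail a0 bs.
pose S M := series (fun k => c k * (h1 + h2) ^+ k) M.
have pow_le k : (cabs h1 + cabs h2) ^+ k <= s ^+ k.
  by rewrite lerXn2r// nnegrE ?addr_ge0 ?cabs_ge0.
have H1 M : cabs (L - S M) <= T M.
  apply: cseries_tail cL _ => n; apply: le_trans (hT M n).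
  apply: ler_sum => k _; rewrite cabsM cabsX ler_wpM2l ?cabs_ge0//.
  apply: le_trans (pow_le k); rewrite lerXn2r// ?nnegrE ?addr_ge0 ?cabs_ge0//.
  exact: cabsD.
have H2 M : cabs (series (fun m => B m * h2 ^+ m) M - S M) <= T M.
  have : (fun K => \sum_(0 <= m < M) series (taylor_term c h1 m) K * h2 ^+ m) @ \oo
      --> series (fun m => B m * h2 ^+ m) M.
    by apply: ccvg_sum => m; apply: ccvgMr; exact: cB.
  move=> cs.
  have : cabs (\sum_(0 <= m < M) series (taylor_term c h1 m) K * h2 ^+ m - S M)
     @[K --> \oo] --> cabs (series (fun m => B m * h2 ^+ m) M - S M).
    apply: cvg_cabs; apply: (ccvgB cs).
    exact: cvg_cst.
  (* Here [K] tends to infinity with [M] fixed. For [k < M] the sum over [m < M] is a complete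
     binomial expansion and cancels [S M]; the indices from [M] to [K] are controlled by [T M]. *)
  move=> /cvgr_to_le; apply; exists M => // K /= MK.
  have E (k : nat) : \sum_(0 <= m < M) taylor_term c h1 m k * h2 ^+ m =
     c k * \sum_(0 <= m < M) 'C(k, m)%:R * h1 ^+ (k - m) * h2 ^+ m.
    rewrite mulr_sumr; apply: eq_bigr => m _; rewrite /taylor_term; ring.
  have -> : \sum_(0 <= m < M) series (taylor_term c h1 m) K * h2 ^+ m =
      \sum_(0 <= k < K) c k * \sum_(0 <= m < M) 'C(k, m)%:R * h1 ^+ (k - m) * h2 ^+ m.
    under [RHS]eq_bigr do rewrite -E.
    rewrite exchange_big /=; apply: eq_bigr => m _.
    by rewrite /series /= mulr_suml.
  rewrite (big_cat_nat _ MK)//= /S /series /=.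
  have -> : \sum_(0 <= k < M) c k * (\sum_(0 <= m < M) 'C(k, m)%:R * h1 ^+ (k - m) * h2 ^+ m)
     = \sum_(0 <= k < M) c k * (h1 + h2) ^+ k.
    by apply: eq_big_nat => k /andP[_ kM]; rewrite binomial_sum.
  rewrite addrAC subrr add0r; apply: le_trans (cabs_sum _ _ _) _.
  apply: le_trans (hT M K); apply: ler_sum => k _.
  rewrite cabsM ler_wpM2l ?cabs_ge0//; apply: le_trans (cabs_sum _ _ _) _.
  apply: le_trans (pow_le k).
  apply: le_trans (binomial_sum_le k M (cabs_ge0 h1) (cabs_ge0 h2)).
  by apply: ler_sum => m _; rewrite !cabsM cabs_nat !cabsX.
apply/cvg_cabsP; apply: (@squeeze_cvgr _ _ _ _ (fun=> 0) (fun M => T M + T M)).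
- apply: nearW => M; rewrite cabs_ge0/=.
  rewrite -(subrKA (S M)) (le_trans (cabsD _ _))// lerD// cabsB; exact: H1.
- exact: cvg_cst.
- by rewrite -[X in _ --> X](addr0 0); exact: cvgD.
Qed.

(** In characteristic zero [X^N - 1] is separable, so it has [N] distinct roots in a closed field,
    and among [N] distinct [N]-th roots of unity one is primitive. *)
Lemma primitive_root_exists (N : nat) : (0 < N)%N ->
  exists w : cplx R, N.-primitive_root w.
Proof.
pose p : {poly cplx R} := 'X^N - 1; have [r Dp] := closed_field_poly_normal p.
move=> n_gt0; rewrite (monicP _) ?monicXnsubC // scale1r in Dp.
have rn1 : all N.-unity_root r by apply/allP=> z; rewrite -root_prod_XsubC -Dp.
have sz_r : (N < (size r).+1)%N.
  by rewrite -(size_prod_XsubC r id) -Dp size_XnsubC.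
have [|z] := hasP (has_prim_root n_gt0 rn1 _ sz_r); last by exists z.
by rewrite -separable_prod_XsubC -Dp separable_Xn_sub_1 // pnatr_eq0 -lt0n.
Qed.

Lemma primitive_root_cabs (N : nat) (w : cplx R) : N.-primitive_root w -> cabs w = 1.
Proof.
move=> wN; have N0 := prim_order_gt0 wN.
apply/eqP; rewrite -(@pexpr_eq1 _ _ N) ?cabs_ge0//.
by rewrite -cabsX prim_expr_order// cabs1.
Qed.

Lemma primitive_root_sum (N : nat) (w : cplx R) (j : nat) : N.-primitive_root w ->
  ~~ (N %| j)%N -> \sum_(0 <= k < N) (w ^+ k) ^+ j = 0.
Proof.
move=> wN Nj; have w1 : w ^+ j - 1 != 0 by rewrite subr_eq0 -(prim_order_dvd wN).
apply: (mulfI w1); rewrite mulr0 big_mkord.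
under eq_bigr do rewrite exprAC.
by rewrite -subrX1 exprAC (prim_expr_order wN) expr1n subrr.
Qed.

(* The average of [D] against the [n]-th power character over the [N]-th roots
   of unity; for large [N] it isolates the [n]-th coefficient of [D]. *)
Definition root_average (D : cplx R -> cplx R) (N n : nat) (w z : cplx R) :=
  N%:R^-1 * \sum_(0 <= k < N) D (z * w ^+ k) * (w ^+ k) ^+ (N - n).

(** The average is exact on the partial sum of length [N], and the remainder of [D] on the circle is
    at most the tail [T N]. The choice of [T] precedes that of [D], [z], [n] and [w]. *)
Lemma root_average_cvg (r : R) (d : nat -> cplx R) : 0 <= r ->
  bsum (fun k => cabs (d k) * r ^+ k) ->
  exists T : nat -> R, T @ \oo --> (0 : R) /\
  forall (D : cplx R -> cplx R) z N n w, cabs z = r ->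
    (forall x, cabs x = r -> series (fun k => d k * x ^+ k) @ \oo --> D x) ->
    N.-primitive_root w -> (n < N)%N ->
    cabs (root_average D N n w z - d n * z ^+ n) <= T N.
Proof.
move=> r0 bd.
have [T [T0 hT]] := bsum_tail (fun k => mulr_ge0 (cabs_ge0 (d k)) (exprn_ge0 k r0)) bd.
exists T; split=> // D z N n w zr hD wN nN.
have w1 := primitive_root_cabs wN; have N0 := prim_order_gt0 wN.
have NN0 : (N%:R : cplx R) != 0 by rewrite pnatr_eq0 -lt0n.
have NR0 : 0 < (N%:R : R) by rewrite ltr0n.
have zk k : cabs (z * w ^+ k) = r by rewrite cabsM cabsX w1 expr1n mulr1.
have key : \sum_(0 <= k < N) series (fun j => d j * (z * w ^+ k) ^+ j) N * (w ^+ k) ^+ (N - n)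
    = N%:R * (d n * z ^+ n).
  rewrite /series /=; under eq_bigr do rewrite mulr_suml.
  rewrite exchange_big /= big_mkord (bigD1 (Ordinal nN))//= [X in _ + X]big1 ?addr0.
    rewrite mulr_natl -[N in RHS]subn0 -sumr_const_nat; apply: eq_bigr => k _.
    rewrite exprMn -!mulrA -exprD subnKC ?(ltnW nN)// exprAC.
    by rewrite (prim_expr_order wN) expr1n mulr1.
  (* For [j, n < N], the number [j + (N - n)] is a multiple of [N] only if [j = n], so every other
     exponent averages to zero. *)
  move=> j /eqP jn.
  under eq_bigr do rewrite exprMn -!mulrA -exprD mulrA.
  rewrite -mulr_sumr (primitive_root_sum wN) ?mulr0//.
  apply/negP => Nj; apply: jn; apply: val_inj => /=.
  have jN := ltn_ord j; move: Nj => /dvdnP[q]; rewrite addnBA ?(ltnW nN)// => qE.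
  have : (j + N = q * N + n)%N by rewrite -qE subnK// (leq_trans (ltnW nN))// leq_addl.
  case: q {qE} => [|[|q]] E; nia.
have -> : root_average D N n w z - d n * z ^+ n = N%:R^-1 *
   \sum_(0 <= k < N) (D (z * w ^+ k) - series (fun j => d j * (z * w ^+ k) ^+ j) N)
      * (w ^+ k) ^+ (N - n).
  under [in RHS]eq_bigr do rewrite mulrBl.
  by rewrite sumrB key mulrBr mulKf.
rewrite cabsM cabsV cabs_nat mulrC ler_pdivrMr//.
apply: le_trans (cabs_sum _ _ _) _; rewrite mulrC mulr_natl.
rewrite -[N in T N *+ N]subn0 -sumr_const_nat subn0 ler_sum// => k _.
rewrite cabsM !cabsX w1 !expr1n mulr1.
apply: cseries_tail; first exact: hD.
move=> K; apply: le_trans (hT N K); apply: ler_sum => j _.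
by rewrite cabsM cabsX zk.
Qed.

(** Cauchy's estimate: the root averages of [D] are bounded by [M] and tend to the monomial of
    degree [n]. *)
Lemma power_coef_le (r M : R) (d : nat -> cplx R) (D : cplx R -> cplx R) n : 0 <= r ->
  bsum (fun k => cabs (d k) * r ^+ k) ->
  (forall x, cabs x = r -> series (fun k => d k * x ^+ k) @ \oo --> D x) ->
  (forall x, cabs x = r -> cabs (D x) <= M) ->
  cabs (d n) * r ^+ n <= M.
Proof.
move=> r0 bd hD hM; have [T [T0 hT]] := root_average_cvg r0 bd.
have zr : cabs (r%:C : cplx R) = r by rewrite cabsR ger0_norm.
have : (M + T N) @[N --> \oo] --> M + 0 by apply: cvgD => //; exact: cvg_cst.
rewrite addr0 => /cvgr_to_ge; apply; exists n.+1 => // N /= nN.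
have [w wN] := primitive_root_exists (leq_trans (ltn0Sn _) nN).
have w1 := primitive_root_cabs wN; have N0 := prim_order_gt0 wN.
have -> : cabs (d n) * r ^+ n = cabs (root_average D N n w r%:C -
  (root_average D N n w r%:C - d n * r%:C ^+ n)).
  by rewrite opprB addrC subrK cabsM cabsX zr.
rewrite (le_trans (cabsD _ _))// cabsN lerD//; last exact: hT.
rewrite cabsM cabsV cabs_nat mulrC ler_pdivrMr ?ltr0n//.
apply: le_trans (cabs_sum _ _ _) _; rewrite mulr_natr.
rewrite -[N in M *+ N]subn0 -sumr_const_nat ler_sum// => k _.
rewrite cabsM !cabsX w1 !expr1n mulr1 hM// cabsM cabsX w1 expr1n mulr1.
exact: zr.
Qed.

(** Cauchy's estimate with bound 0, applied to the difference of the two series on a small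
    circle. *)
Lemma power_series_unique z0 (rho rho' : R) c c' f :
  0 < rho -> 0 < rho' -> has_power_series z0 rho c f ->
  has_power_series z0 rho' c' f -> c = c'.
Proof.
move=> rho0 rho'0 hc hc'; apply/funext => n; apply/eqP; rewrite -subr_eq0; apply/eqP.
pose r := Num.min rho rho' / 2.
have m0 : 0 < Num.min rho rho' by rewrite lt_min rho0.
have r0 : 0 < r by rewrite divr_gt0.
have rm : r < Num.min rho rho' by rewrite /r; lra.
have [r1 r2] : r < rho /\ r < rho' by move: rm; rewrite lt_min => /andP.
have bc := power_series_bsum hc (introT andP (conj (ltW r0) r1)).
have bc' := power_series_bsum hc' (introT andP (conj (ltW r0) r2)).
have bd : bsum (fun k => cabs (c k - c' k) * r ^+ k).
  have [M hM] := bc; have [M' hM'] := bc'; exists (M + M') => k.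
  apply: le_trans (lerD (hM k) (hM' k)); rewrite -big_split/=.
  apply: ler_sum => j _; rewrite -mulrDl ler_wpM2r ?exprn_ge0 ?(ltW r0)//.
  by rewrite (le_trans (cabsD _ _))// cabsN.
apply: cabs_eq0; apply/eqP; rewrite eq_le cabs_ge0 andbT.
rewrite -(pmulr_lle0 _ (exprn_gt0 n r0)).
apply: (@power_coef_le r 0 (fun k => c k - c' k) (fun=> 0)) => //; first exact: ltW.
  move=> x xr.
  have e1 := hc (z0 + x); have e2 := hc' (z0 + x).
  move: e1 e2; rewrite addrAC subrr add0r xr => /(_ r1) e1 /(_ r2) e2.
  have := ccvgB e1 e2; rewrite subrr.
  under eq_fun do rewrite /series /= -sumrB; under eq_fun do under eq_bigr do rewrite -mulrBl.
  exact.
by move=> x _; rewrite cabs0.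
Qed.

Lemma power_series_shift z0 z1 (rho : R) c f : has_power_series z0 rho c f ->
  cabs (z1 - z0) < rho ->
  exists B : nat -> cplx R,
    (forall m, series (taylor_term c (z1 - z0) m) @ \oo --> B m) /\
    has_power_series z1 (rho - cabs (z1 - z0)) B f.
Proof.
move=> hf hz.
have [B hB] : exists B : nat -> cplx R,
    forall m, series (taylor_term c (z1 - z0) m) @ \oo --> B m.
  apply: (@taylor_coef_exists _ _ ((cabs (z1 - z0) + rho) / 2)); last by lra.
  apply: (power_series_bsum hf); have := cabs_ge0 (z1 - z0); lra.
exists B; split=> // z hzz.
have zE : z1 - z0 + (z - z1) = z - z0 by rewrite addrC addrA subrK.
apply: (@taylor_reexpansion c (z1 - z0) (z - z1) (cabs (z1 - z0) + cabs (z - z1))) => //.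
  by apply: (power_series_bsum hf); rewrite addr_ge0 ?cabs_ge0//=; lra.
rewrite zE; apply: hf; rewrite -zE (le_lt_trans (cabsD _ _))//; lra.
Qed.

Lemma power_series_analytic c f : has_power_series 0 1 c f -> analytic_on_disc f.
Proof.
move=> hf z0 hz0; have hz : cabs (z0 - 0) < 1 by rewrite subr0.
have [B [_ hB]] := power_series_shift hf hz.
exists B, (1 - cabs (z0 - 0)); split => //; by rewrite subr_gt0.
Qed.

Lemma power_series_radius_le z0 (rho rho' : R) c f : rho' <= rho ->
  has_power_series z0 rho c f -> has_power_series z0 rho' c f.
Proof. by move=> le_rho hf z hz; apply: hf; exact: lt_le_trans hz le_rho. Qed.

End power_series.

(** * Analytic functions on the disc *)

Section global_power_series.
Context {R : realType}.
Implicit Types (c : nat -> cplx R) (z h : cplx R) (f : cplx R -> cplx R).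

Lemma nbhs_plane (x : R * R) (e : R) : 0 < e ->
  nbhs x [set u | cabs (of_plane u - of_plane x) < e].
Proof.
move=> e0; have e2 : 0 < e / 2 by rewrite divr_gt0.
exists (ball x.1 (e / 2), ball x.2 (e / 2)); first by split; exact: nbhsx_ballx.
move=> [u v] [hu hv]; change (cabs (of_plane (u, v) - of_plane x) < e).
apply: (le_lt_trans (cabs_ReIm _)).
rewrite /of_plane /= [ltRHS]splitr ltrD// distrC; [exact: hu|exact: hv].
Qed.

(* Cauchy estimates with uniform constants: near a point the radius and the
   bound are inherited by re-expansion, and the closed disc is compact. *)
Lemma analytic_uniform f (rho : R) : analytic_on_disc f -> rho < 1 ->
  exists2 d : R, 0 < d & exists b : cplx R -> nat -> cplx R,
    forall z, cabs z <= rho ->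
      has_power_series z d (b z) f /\ forall m, cabs (b z m) * d ^+ m <= d^-1.
Proof.
move=> af rho1.
pose P (d : R) (u : R * R) := cabs (of_plane u) <= rho ->
  exists b : nat -> cplx R, has_power_series (of_plane u) d b f /\
    forall m, cabs (b m) * d ^+ m <= d^-1.
have cK : compact (`[-1, 1]%classic `*` `[-1, 1]%classic : set (R * R)).
  by apply: compact_setX; exact: segment_compact.
(* Compactness of a square containing the disc turns a local property, valid for all small [d], into
   one with a common [d]. Points of modulus above [rho] satisfy [P] vacuously. *)
suff nP : \forall d \near 0^'+,
    (`[-1, 1]%classic `*` `[-1, 1]%classic : set (R * R)) `<=` P d.
  have [d [d0 hd]] : exists d : R, 0 < d /\
      (`[-1, 1]%classic `*` `[-1, 1]%classic : set (R * R)) `<=` P d.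
    exact: filter_ex (filterI (nbhs_right_gt 0) nP).
  exists d => //.
  suff /choice[b hb] : forall z, exists b : nat -> cplx R, cabs z <= rho ->
      has_power_series z d b f /\ forall m, cabs (b m) * d ^+ m <= d^-1.
    by exists b.
  move=> z; have [hz|hz] := leP (cabs z) rho; last by exists (fun=> 0).
  have z1 := le_trans hz (ltW rho1).
  have [||b hb] := hd (complex.Re z, complex.Im z); last 1 first.
  - by exists b; move: hb; rewrite /of_plane /=; case: z {hz z1}.
  - rewrite /= !in_itv/= -!ler_norml.
    by rewrite (le_trans (normRe_cabs z))// (le_trans (normIm_cabs z)).
  - by rewrite /of_plane /=; case: z hz {z1}.
move: cK => /compact_near_coveringP/(_ R (0 : R)^'+ P _); apply => x _.
have [hx|hx] := leP (cabs (of_plane x)) rho; last first.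
  exists ([set u | cabs (of_plane u - of_plane x) < cabs (of_plane x) - rho], setT).
    split; last exact: filterT.
    by apply: nbhs_plane; rewrite subr_gt0.
  move=> [u d] /= [hu _] hru; exfalso.
  have := cabs_dist (of_plane u) (of_plane x).
  rewrite leNgt => /negP; apply; rewrite (lt_le_trans hu)// distrC.
  by rewrite (le_trans _ (ler_norm _))// lerD2l lerN2.
have [c [r [r0 hc]]] := af _ (le_lt_trans hx rho1).
have r2 : 0 <= r / 2 < r by lra.
have [M hM] := power_series_bsum hc r2.
(* Within [r / 4] of [x] a radius [3r / 4] remains, and for [d < r / 4] the bound [M] at radius
   [r / 2] applies to the shifted coefficients. Taking [d] below the inverse of [1 + |M|] lets the
   single number [d] give both the radius and the bound [d^-1]. *)
exists ([set u | cabs (of_plane u - of_plane x) < r / 4],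
  [set d | 0 < d /\ d < Num.min (r / 4) (1 + `|M|)^-1]).
  split; first by apply: nbhs_plane; lra.
  near=> d; split => //; near: d; apply: nbhs_right_lt.
  by rewrite lt_min; apply/andP; split; [lra|rewrite invr_gt0 ltr_pwDl].
move=> [u d] [hu [d0]]; rewrite lt_min => /andP[dr dM] _.
have {}hu : cabs (of_plane u - of_plane x) < r / 4 := hu.
have hur : cabs (of_plane u - of_plane x) < r by lra.
have [B [hB hBf]] := power_series_shift hc hur.
exists B; split; first by apply: power_series_radius_le hBf; lra.
move=> m; apply: (@le_trans _ _ M); last first.
  have M1 : 0 < 1 + `|M| by rewrite ltr_pwDl.
  have : 1 + `|M| <= d^-1 by rewrite -[leLHS]invrK lef_pV2 ?posrE ?invr_gt0// ltW.
  by have := ler_norm M; lra.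
rewrite -ler_pdivlMr ?exprn_gt0//; apply: cabs_series_le (hB m) _ => n.
rewrite ler_pdivlMr ?exprn_gt0// mulr_suml.
by apply: (taylor_term_sum_le _ _ hM (ltW d0)); lra.
Unshelve. all: by end_near.
Qed.

(** Cauchy's estimate is applied to each Taylor coefficient as a function of its centre [x], on
    circles [cabs x = s < r]. It bounds every binomial term of [(s + d) ^+ n * cabs (c n)], so the
    coefficients [c] decay as for radius [r + d]. Beyond [r] the sum is identified with [f] by
    re-expanding about a point inside. *)
Lemma power_series_extend f c (rho r d : R) (b : cplx R -> nat -> cplx R) :
  0 < r -> r <= rho -> 0 < d ->
  (forall z, cabs z <= rho ->
      has_power_series z d (b z) f /\ forall m, cabs (b z m) * d ^+ m <= d^-1) ->
  has_power_series 0 r c f -> has_power_series 0 (r + d) c f.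
Proof.
move=> r0 rrho d0 hb hc.
have taylor_b x m : cabs x < r -> series (taylor_term c x m) @ \oo --> b x m.
  move=> xr; have xr0 : cabs (x - 0) < r by rewrite subr0.
  have [B [hB hBf]] := power_series_shift hc xr0.
  have [hx _] := hb x (ltW (lt_le_trans xr rrho)).
  rewrite -(power_series_unique _ d0 hBf hx) ?subr_gt0//.
  by have := hB m; rewrite subr0.
(* Multiplying the [m]-th Taylor coefficient at [x] by [x ^+ m] gives a power series in [x] with
   coefficients ['C(k, m)%:R * c k], to which Cauchy's estimate applies. *)
have coef_le (s : R) m n : 0 < s < r -> 'C(n, m)%:R * s ^+ (n - m) * d ^+ m * cabs (c n) <= d^-1.
  move=> /andP[s0 sr]; have [nm|mn] := ltnP n m.
    by rewrite bin_small// !mul0r invr_ge0 ltW.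
  have bs : bsum (fun k => cabs ('C(k, m)%:R * c k) * s ^+ k).
    have bs0 := @power_series_bsum R 0 r ((s + r) / 2) c f hc ltac:(lra).
    have hs : cabs (s%:C : cplx R) < (s + r) / 2 by rewrite cabsR ger0_norm; lra.
    apply: (bsum_le _ (bsum_scale (exprn_ge0 m (ltW s0)) (taylor_term_bsum m bs0 hs))) => k.
    rewrite /taylor_term !cabsM !cabsX cabsR (gtr0_norm s0).
    have [km|mk] := ltnP k m; first by rewrite bin_small// cabs0 !mul0r mulr0.
    have -> : s ^+ k = s ^+ (k - m) * s ^+ m by rewrite -exprD subnK.
    by rewrite le_eqVlt; apply/orP; left; apply/eqP; ring.
  have := @power_coef_le R s (s ^+ m * (d^-1 / d ^+ m)) _ (fun x => b x m * x ^+ m) n (ltW s0) bs.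
  rewrite cabsM cabs_nat => H.
  have : 'C(n, m)%:R * cabs (c n) * s ^+ n <= s ^+ m * (d^-1 / d ^+ m).
    apply: H => x xs.
      have : (series (taylor_term c x m) K * x ^+ m) @[K --> \oo] --> b x m * x ^+ m.
        by apply: ccvgMr; apply: taylor_b; rewrite xs.
      under eq_fun => K.
        rewrite (_ : _ * _ = series (fun k => 'C(k, m)%:R * c k * x ^+ k) K); last first.
          rewrite /series /= mulr_suml; apply: eq_bigr => k _; rewrite /taylor_term.
          have [km|mk] := ltnP k m; first by rewrite bin_small// !mul0r.
          have -> : x ^+ k = x ^+ (k - m) * x ^+ m by rewrite -exprD subnK.
          by rewrite !mulrA.
        over.
      exact.
    rewrite cabsM cabsX xs mulrC ler_wpM2l ?exprn_ge0 ?(ltW s0)//.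
    rewrite ler_pdivlMr ?exprn_gt0//.
    have [|_ ->//] := hb x; by rewrite xs (le_trans (ltW sr)).
  have -> : s ^+ n = s ^+ (n - m) * s ^+ m by rewrite -exprD subnK.
  move=> h.
  have {h} : 'C(n, m)%:R * cabs (c n) * s ^+ (n - m) <= d^-1 / d ^+ m.
    rewrite -(ler_pM2l (exprn_gt0 m s0)); apply: le_trans h.
    by rewrite le_eqVlt; apply/orP; left; apply/eqP; ring.
  rewrite ler_pdivlMr ?exprn_gt0//; apply: le_trans.
  by rewrite le_eqVlt; apply/orP; left; apply/eqP; ring.
have bound (s : R) : 0 <= s < r + d -> bsum (fun k => cabs (c k) * s ^+ k).
  move=> /andP[s0 srd].
  (* The margin leaves [s < (r - e) + (d - e)]. Replacing [d] by [d - e] makes the sum over [m]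
     geometric of ratio [(d - e) / d], hence bounded independently of [k]. *)
  pose e := Num.min ((r + d - s) / 3) (Num.min (r / 2) (d / 2)).
  have e0 : 0 < e by rewrite !lt_min; apply/and3P; split; lra.
  have [e1 e2 e3] : [/\ e <= (r + d - s) / 3, e <= r / 2 & e <= d / 2].
    by have := lexx e; rewrite {2}/e !le_min => /and3P.
  have [M hM] := @bsum_geo R d^-1 ((d - e) / d) ltac:(by rewrite invr_ge0 ltW)
    ltac:(by rewrite divr_ge0 ?ltr_pdivrMr//=; lra).
  apply: (@bsum_pow_lt _ _ M ((r - e) + (d - e))).
  - by move=> k; exact: cabs_ge0.
  - move=> k; rewrite -(binomial_sum _ _ (ltnSn k)) mulr_sumr.
    apply: le_trans (hM k.+1); apply: ler_sum => m _.
    have := @coef_le (r - e) m k ltac:(lra).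
    rewrite expr_div_n => h.
    have := ler_wpM2r (_ : 0 <= (d - e) ^+ m / d ^+ m) h.
    rewrite divr_ge0 ?exprn_ge0 ?(ltW d0)//; last lra.
    move=> /(_ isT); apply: le_trans.
    rewrite le_eqVlt; apply/orP; left; apply/eqP.
    by field; rewrite expf_neq0// gt_eqF.
  - lra.
move=> z; rewrite subr0 => hz.
have [zr|rz] := ltP (cabs z) r.
  by have := hc z; rewrite subr0; apply.
have z0 : 0 < cabs z := lt_le_trans r0 rz.
(* The point [z1] on the ray of [z] must have modulus below [r], where its Taylor coefficients are
   known, and lie within [d] of [z]. *)
pose s := Num.max (r / 2) ((cabs z - d + r) / 2).
have [s1 s2 s3] : [/\ 0 < s, s < r & cabs z - d < s].
  by split; rewrite /s ?lt_max ?gt_max; [apply/orP; left|apply/andP; split|apply/orP; right]; lra.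
pose z1 : cplx R := (s / cabs z)%:C * z.
have z1s : cabs z1 = s by rewrite cabsM cabsR ger0_norm ?divfK ?gt_eqF// divr_ge0// ltW.
have zz1 : cabs (z - z1) = cabs z - s.
  have -> : z - z1 = (1 - s / cabs z)%:C * z by rewrite rmorphB rmorph1 mulrBl mul1r.
  rewrite cabsM cabsR ger0_norm ?mulrBl ?mul1r ?divfK ?gt_eqF//.
  by rewrite subr_ge0 ler_pdivrMr// mul1r; lra.
have [hz1 _] := hb z1 ltac:(rewrite z1s; lra).
have bz : bsum (fun k => cabs (c k) * cabs z ^+ k) by apply: bound; lra.
have [L hL] : exists L : cplx R, series (fun k => c k * z ^+ k) @ \oo --> L.
  by apply: cseries_cvg; apply: (bsum_le _ bz) => k; rewrite cabsM cabsX.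
(* Both are sums of the series with coefficients [b z1] at [z - z1]: [f z] by the local expansion,
   [L] by re-expansion of the series at 0. *)
have -> : f z = L; last by move: hL.
apply: ccvg_unique (hz1 z _) _; first by rewrite zz1; lra.
apply: (@taylor_reexpansion R c z1 (z - z1) (cabs z) L (b z1) bz).
- by rewrite z1s zz1 addrC subrK.
- by rewrite (addrC z1) subrK; exact: hL.
- by move=> m; apply: taylor_b; rewrite z1s.
Qed.

Lemma analytic_power_series f : analytic_on_disc f ->
  exists c, has_power_series 0 1 c f.
Proof.
move=> af; have [|c [r [r0 hc]]] := af 0; first by rewrite /unit_disc /mkset cabs0 ltr01.
exists c => z; rewrite subr0 => z1; pose rho := (cabs z + 1) / 2.
have zrho : cabs z < rho by rewrite /rho; lra.
have rho1 : rho < 1 by rewrite /rho; lra.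
have [d d0 [b hb]] := analytic_uniform af rho1.
(* The cap at [rho] keeps every step where the uniform constant [d] is valid. *)
have ext (k : nat) : has_power_series 0 (Num.min (r + k%:R * d) rho) c f.
  have rho0 : 0 < rho := le_lt_trans (cabs_ge0 z) zrho.
  elim: k => [|k IH].
    by apply: power_series_radius_le hc; rewrite mul0r addr0 ge_min lexx.
  have := power_series_extend _ _ d0 hb IH; rewrite lt_min rho0 ge_min lexx orbT.
  rewrite ltr_pwDl ?mulr_ge0 ?(ltW d0)// => /(_ isT isT).
  apply: power_series_radius_le; rewrite -natr1 mulrDl mul1r addrA.
  rewrite ge_min; have [h|h] := leP (r + k%:R * d) rho; first by rewrite lexx.
  by apply/orP; right; lra.
have [k kd] : exists k : nat, rho <= k%:R * d.
  exists (Num.truncn (rho / d)).+1; rewrite -ler_pdivrMr// ltW//.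
  by rewrite truncnS_gt.
have := ext k z; rewrite subr0; apply.
by rewrite lt_min zrho andbT; lra.
Qed.

End global_power_series.

(** * Lebesgue measure on the plane *)

(* [pushforward m f] with its measure structure, which is only available once
   the measurability of [f] is known. *)
Definition image_measure d1 d2 (T1 : measurableType d1) (T2 : measurableType d2)
    (R : realType) (m : {measure set T1 -> \bar R}) (f : T1 -> T2)
    (mf : measurable_fun setT f) : {measure set T2 -> \bar R} :=
  measure_function_pushforward__canonical__measure_function_Measure m mf.

Lemma ge0_integral_image_measure d1 d2 (T1 : measurableType d1)
    (T2 : measurableType d2) (R : realType) (m : {measure set T1 -> \bar R})
    (f : T1 -> T2) (mf : measurable_fun setT f) (h : T2 -> \bar R) :
  measurable_fun setT h -> (forall y, 0 <= h y)%E ->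
  (\int[image_measure m mf]_y h y = \int[m]_x h (f x))%E.
Proof. by move=> mh h0; rewrite ge0_integral_pushforward. Qed.

Section plane_measure.
Context {R : realType}.
Local Notation RM := (measurableTypeR R).
Local Notation mu := (@lebesgue_measure R).
Local Notation mu2 := (mu \x mu)%E.
Local Open Scope ereal_scope.

Lemma measurable_affine (a b : R) : measurable_fun [set: RM] (fun x : RM => a * x + b : RM)%R.
Proof. by apply: measurable_funD => //; apply: measurable_funM. Qed.

(** Lebesgue measure is determined by its values on half-open intervals, where the scaled image
    measure agrees with it. *)
Lemma ge0_integral_affine (f : RM -> \bar R) (a b : R) : (0 < a)%R ->
  measurable_fun setT f -> (forall x, 0 <= f x) ->
  \int[mu]_x f x = a%:E * \int[mu]_x f (a * x + b)%R.
Proof.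
move=> a0 mf f0.
pose nu := image_measure mu (measurable_affine a b).
have E (A : set RM) : measurable A -> mu A = mscale (NngNum (ltW a0)) nu A.
  apply: lebesgue_measure_unique => _ [[c d] _ <-].
  have nuE : nu `]c, d]%classic = mu `](c - b) / a, (d - b) / a]%classic%R.
    rewrite /nu /= /pushforward; congr (mu _).
    by apply/seteqP; split => x /=; rewrite !in_itv/= ltr_pdivrMr// ler_pdivlMr//;
      rewrite ltrBlDr lerBrDr mulrC.
  transitivity (a%:E * mu `](c - b) / a, (d - b) / a]%classic%R); last first.
    by rewrite -nuE.
  rewrite /=.
  rewrite !lebesgue_measure_itv/= !lte_fin ltr_pM2r ?invr_gt0// ltrD2r.
  case: ifPn => _; last by rewrite mule0.
  by rewrite -!EFinD -EFinM; congr EFin; field; rewrite gt_eqF.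
transitivity (\int[mscale (NngNum (ltW a0)) nu]_x f x).
  by apply: eq_measure_integral => A mA _; exact: E.
by rewrite ge0_integral_mscale// ge0_integral_image_measure.
Qed.

Lemma measurable_pair_fun (f g : RM * RM -> RM) :
  measurable_fun setT f -> measurable_fun setT g ->
  measurable_fun setT (fun u => (f u, g u) : RM * RM).
Proof. by move=> mf mg; exact: measurable_fun_pair. Qed.

Lemma measurable_lin (a b : R) :
  measurable_fun [set: RM * RM] (fun u : RM * RM => a * u.1 + b * u.2 : RM)%R.
Proof.
by apply: measurable_funD; apply: measurable_funM => //.
Qed.

(** By Tonelli: on each horizontal line the shear is a translation. *)
Lemma ge0_integral_shear1 (F : RM * RM -> \bar R) (a : R) :
  measurable_fun setT F -> (forall u, 0 <= F u) ->
  \int[mu2]_u F (u.1 + a * u.2, u.2)%R = \int[mu2]_u F u.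
Proof.
move=> mF F0.
have mG : measurable_fun setT (fun u : RM * RM => F (u.1 + a * u.2, u.2)%R).
  apply: measurableT_comp => //; apply: measurable_pair_fun => //.
  have := measurable_lin 1 a; by under eq_fun do rewrite mul1r.
rewrite (fubini_tonelli2 _ mG (fun=> F0 _)) (fubini_tonelli2 _ mF F0).
apply: eq_integral => y _; rewrite /fubini_G /=.
rewrite [RHS](@ge0_integral_affine _ 1 (a * y)%R)// ?mul1e.
  by apply: eq_integral => x _; rewrite mul1r.
exact: measurable_fun_pair1.
Qed.

Lemma ge0_integral_shear2 (F : RM * RM -> \bar R) (a : R) :
  measurable_fun setT F -> (forall u, 0 <= F u) ->
  \int[mu2]_u F (u.1, u.2 + a * u.1)%R = \int[mu2]_u F u.
Proof.
move=> mF F0.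
have mG : measurable_fun setT (fun u : RM * RM => F (u.1, u.2 + a * u.1)%R).
  apply: measurableT_comp => //; apply: measurable_pair_fun => //.
  have := measurable_lin a 1; by under eq_fun do rewrite mul1r addrC.
rewrite (fubini_tonelli1 _ mG (fun=> F0 _)) (fubini_tonelli1 _ mF F0).
apply: eq_integral => x _; rewrite /fubini_F /=.
rewrite [RHS](@ge0_integral_affine _ 1 (a * x)%R)// ?mul1e.
  by apply: eq_integral => y _; rewrite mul1r.
exact: measurable_fun_pair2.
Qed.

Lemma ge0_integral_scale (F : RM * RM -> \bar R) (r : R) : (0 < r)%R ->
  measurable_fun setT F -> (forall u, 0 <= F u) ->
  \int[mu2]_u F u = (r ^+ 2)%:E * \int[mu2]_u F (r * u.1, r * u.2)%R.
Proof.
move=> r0 mF F0.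
have mG : measurable_fun setT (fun u : RM * RM => F (r * u.1, r * u.2)%R).
  apply: measurableT_comp => //; apply: measurable_pair_fun.
    by apply: measurable_funM.
  by apply: measurable_funM.
rewrite (fubini_tonelli1 _ mG (fun=> F0 _)) (fubini_tonelli1 _ mF F0).
have mF1 : measurable_fun setT (fubini_F mu F) by exact: measurable_fun_fubini_tonelli_F.
have F10 x : 0 <= fubini_F mu F x by apply: integral_ge0.
rewrite (ge0_integral_affine 0 r0 mF1 F10) expr2 EFinM -muleA; congr (_ * _).
rewrite -ge0_integralZl//; last 3 first.
- exact: measurable_fun_fubini_tonelli_F.
- by move=> x _; apply: integral_ge0.
- by rewrite lee_fin ltW.
apply: eq_integral => x _; rewrite /fubini_F addr0.
rewrite (ge0_integral_affine 0 r0)//; last exact: measurable_fun_pair2.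
by congr (_ * _); apply: eq_integral => y _; rewrite addr0.
Qed.

(** A rotation by [theta] is a product of three shears, with coefficients [- t], [s], [- t] for
    [t = tan (theta / 2) = s / (1 + c)]. The half turn, where [t] is infinite, is excluded. *)
Lemma ge0_integral_rotation_aux (F : RM * RM -> \bar R) (c s : R) :
  (c ^+ 2 + s ^+ 2 = 1)%R -> (c != - 1)%R ->
  measurable_fun setT F -> (forall u, 0 <= F u) ->
  \int[mu2]_u F (c * u.1 - s * u.2, s * u.1 + c * u.2)%R = \int[mu2]_u F u.
Proof.
move=> cs c1 mF F0; have c10 : (1 + c != 0)%R by rewrite addrC addr_eq0.
pose t := (s / (1 + c))%R.
have mF1 : measurable_fun setT (fun u : RM * RM => F (u.1 + (- t) * u.2, u.2)%R).
  apply: measurableT_comp => //; apply: measurable_pair_fun => //.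
  have := measurable_lin 1 (- t); by under eq_fun do rewrite mul1r.
have mF2 : measurable_fun setT (fun u : RM * RM =>
    F (u.1 + (- t) * (u.2 + s * u.1), u.2 + s * u.1)%R).
  have ms : measurable_fun [set: RM * RM] (fun u : RM * RM => u.2 + s * u.1 : RM)%R.
    have := measurable_lin s 1; by under eq_fun do rewrite mul1r addrC.
  exact: (measurableT_comp mF1 (measurable_pair_fun measurable_fst ms)).
rewrite -(@ge0_integral_shear1 F (- t)%R)//.
rewrite -(@ge0_integral_shear2 (fun u => F (u.1 + (- t) * u.2, u.2)%R) s)//=.
rewrite -[RHS](@ge0_integral_shear1
  (fun u => F (u.1 + (- t) * (u.2 + s * u.1), u.2 + s * u.1)%R) (- t)%R)//=.
apply: eq_integral => -[x y] _ /=; congr F.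
have ss : (s ^+ 2 = (1 - c) * (1 + c))%R by rewrite -subr_sqr expr1n -cs addrC addKr.
have ts : (t * s = 1 - c)%R by rewrite /t mulrAC -expr2 ss mulfK.
have t1c : (t * (1 + c) = s)%R by rewrite /t divfK.
congr pair.
  transitivity ((1 - t * s) * x - t * (1 + (1 - t * s)) * y)%R; last by ring.
  by rewrite ts opprB addrCA subrr addr0 t1c.
transitivity (s * x + (1 - t * s) * y)%R; last by ring.
by rewrite ts opprB addrCA subrr addr0.
Qed.

End plane_measure.

(** * Rotations and polar coordinates *)

Section plane_polar.
Context {R : realType}.
Local Notation RM := (measurableTypeR R).
Local Notation mu := (@lebesgue_measure R).
Local Notation mu2 := (mu \x mu)%E.
Local Open Scope ereal_scope.

Lemma ge0_integral_rotation (F : RM * RM -> \bar R) (z : cplx R) :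
  cabs z = 1%R -> measurable_fun setT F -> (forall u, 0 <= F u) ->
  \int[mu2]_u F (complex.Re (of_plane u * z), complex.Im (of_plane u * z))%R =
  \int[mu2]_u F u.
Proof.
case: z => c s z1 mF F0.
have cs : (c ^+ 2 + s ^+ 2 = 1)%R.
  rewrite -[LHS]sqr_sqrtr ?addr_ge0 ?sqr_ge0//.
  by move: z1; rewrite /cabs /= => ->; rewrite expr1n.
have [c1|c1] := eqVneq c (- 1)%R; last first.
  rewrite -(ge0_integral_rotation_aux cs c1 mF F0).
  by apply: eq_integral => -[x y] _ /=; congr (F (_, _)); ring.
have s0 : s = 0%R.
  by apply/eqP; rewrite -sqrf_eq0; apply/eqP; move: cs; rewrite c1 sqrrN expr1n; lra.
(* The remaining case, the half turn, is the quarter turn applied twice. *)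
have i2 : (0 ^+ 2 + 1 ^+ 2 = 1 :> R)%R by rewrite expr0n expr1n add0r.
have i1 : (0 != - 1 :> R)%R by rewrite eq_sym oppr_eq0 oner_eq0.
have mF1 : measurable_fun setT (fun u : RM * RM => F (0 * u.1 - 1 * u.2, 1 * u.1 + 0 * u.2)%R).
  apply: measurableT_comp => //; apply: measurable_pair_fun; last exact: measurable_lin.
  rewrite (_ : (fun _ => _) = (fun u : RM * RM => 0 * u.1 + (- 1) * u.2 : RM)%R).
    exact: measurable_lin.
  by apply/funext => u; rewrite mulNr.
rewrite -(ge0_integral_rotation_aux i2 i1 mF F0).
rewrite -(ge0_integral_rotation_aux i2 i1 mF1 (fun=> F0 _)).
by apply: eq_integral => -[x y] _ /=; rewrite c1 s0; congr (F (_, _)); ring.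
Qed.

Lemma measurable_cabs_plane :
  measurable_fun setT (fun u : RM * RM => cabs (of_plane u) : RM).
Proof.
have msq : measurable_fun setT (fun u : RM * RM => u.1 ^+ 2 + u.2 ^+ 2 : RM)%R.
  by apply: measurable_funD; apply: measurable_funX.
apply: (measurableT_comp _ msq).
by apply: continuous_measurable_fun; exact: sqrt_continuous.
Qed.

Definition disc (r : R) : set (RM * RM) := [set u | (cabs (of_plane u) < r)%R].

Lemma measurable_disc r : measurable (disc r).
Proof.
have -> : disc r = (fun u : RM * RM => cabs (of_plane u) : RM) @^-1` `]-oo, r[%classic.
  by apply/seteqP; split => u /=; rewrite in_itv.
rewrite -[X in measurable X]setTI; apply: measurable_cabs_plane => //.
Qed.

Lemma cabs_plane_scale (r : R) (u : RM * RM) : (0 <= r)%R ->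
  cabs (of_plane (r * u.1, r * u.2)%R) = (r * cabs (of_plane u))%R.
Proof.
move=> r0; rewrite -[in RHS](ger0_norm r0) -cabsR -cabsM; congr cabs.
by apply/eqP; rewrite eq_complex /=; apply/andP; split; apply/eqP; ring.
Qed.

Lemma disc_area (r : R) : (0 < r)%R -> mu2 (disc r) = (r ^+ 2)%:E * mu2 (disc 1).
Proof.
move=> r0.
have mi s : measurable_fun setT (fun u : RM * RM => (\1_(disc s) u)%:E : \bar R).
  by apply/measurable_EFinP; apply: measurable_indic; exact: measurable_disc.
have i s : mu2 (disc s) = \int[mu2]_u (\1_(disc s) u)%:E.
  by rewrite integral_indic ?setIT//; exact: measurable_disc.
rewrite !i (ge0_integral_scale r0 (mi r)); last by move=> u; rewrite lee_fin.
congr (_ * _); apply: eq_integral => u _; rewrite !indicE; congr ((nat_of_bool _)%:R%:E).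
apply/idP/idP; rewrite !inE /disc /mkset cabs_plane_scale ?ltW//.
  by rewrite -[X in (_ < X)%R -> _]mulr1 ltr_pM2l.
by rewrite -[X in _ -> (_ < X)%R]mulr1 ltr_pM2l.
Qed.

(** The disc contains a square of side 1/2. Positivity and finiteness of this area are all that the
    polar constant requires. *)
Lemma disc1_area_gt0 : 0 < mu2 (disc 1).
Proof.
have sq0 : 0 < mu2 (`[0, 2^-1]%classic%R `*` `[0, 2^-1]%classic%R : set (RM * RM)).
  rewrite product_measure1E//= !lebesgue_measure_itv/= lte_fin invr_gt0 ltr0n/=.
  by rewrite -EFinD -EFinM lte_fin subr0 mulr_gt0.
apply: (lt_le_trans sq0); apply: le_measure; rewrite ?inE//; first exact: measurableX.
  exact: measurable_disc.
move=> [x y] [/=]; rewrite !in_itv/= => /andP[x0 x1] /andP[y0 y1].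
rewrite /disc /mkset; apply: (le_lt_trans (y := Num.sqrt (2^-1))).
  rewrite /cabs /= ler_wsqrtr//.
  have -> : (2^-1 = 2^-1 ^+ 2 + 2^-1 ^+ 2 :> R)%R by field.
  by rewrite lerD// lerXn2r ?nnegrE// (le_trans x0).
rewrite -[ltRHS]sqrtr1 ltr_sqrt// invf_lt1// ltr1n//.
Qed.

Lemma disc1_area_lty : mu2 (disc 1) < +oo.
Proof.
have sq : mu2 (disc 1) <= mu2 (`[- 1, 1]%classic%R `*` `[- 1, 1]%classic%R : set (RM * RM)).
  apply: le_measure; rewrite ?inE//; [exact: measurable_disc|exact: measurableX|].
  move=> [x y] h; have {}h : (cabs (of_plane (x, y)) < 1)%R := h.
  rewrite /= !in_itv/= -!ler_norml.
  split; rewrite (le_trans _ (ltW h))//.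
    exact: (normRe_cabs (of_plane (x, y))).
  exact: (normIm_cabs (of_plane (x, y))).
apply: (le_lt_trans sq); rewrite product_measure1E//= !lebesgue_measure_itv/= lte_fin.
by case: ifPn => _; rewrite ?mule0// -EFinD -EFinM ltry.
Qed.

(* The region under the diagonal has vertical sections of length [r], so that
   integrating over it produces the weight [r dr] of polar coordinates. *)
Definition under_diagonal : set (RM * RM) := [set u | (0 <= u.2 < u.1)%R].

Lemma measurable_under_diagonal : measurable under_diagonal.
Proof.
have -> : under_diagonal = (snd : RM * RM -> RM) @^-1` `[0%R, +oo[%classic `&`
    (fun u : RM * RM => u.1 - u.2 : RM)%R @^-1` `]0%R, +oo[%classic.
  apply/seteqP; split => u /=; rewrite !in_itv/= !andbT subr_gt0.
    by move=> /andP.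
  by move=> [a b]; apply/andP.
apply: measurableI; rewrite -[X in measurable X]setTI.
  by apply: measurable_snd.
have mB : measurable_fun setT (fun u : RM * RM => u.1 - u.2 : RM)%R.
  by apply: measurable_funB.
by apply: mB.
Qed.

Lemma ge0_integral_under_diagonal (h : RM -> \bar R) :
  measurable_fun setT h -> (forall r, 0 <= h r) ->
  \int[mu2]_(u in under_diagonal) h u.1 = \int[mu]_(r in `[0%R, +oo[) (h r * r%:E).
Proof.
move=> mh h0; rewrite integral_mkcond.
have mG : measurable_fun setT ((fun u : RM * RM => h u.1) \_ under_diagonal).
  apply/(measurable_restrictT _ measurable_under_diagonal).
  by apply: measurable_funTS; exact: (measurableT_comp mh measurable_fst).
have G0 u : 0 <= ((fun u : RM * RM => h u.1) \_ under_diagonal) u.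
  by apply: erestrict_ge0 => ? _.
rewrite (fubini_tonelli1 _ mG G0) [RHS]integral_mkcond; apply: eq_integral => r _.
rewrite /fubini_F patchE; have [r0|r0] := leP 0%R r; last first.
  rewrite memNset /=; last by rewrite in_itv/= andbT; apply/negP; rewrite -ltNge.
  apply: integral0_eq => t _; rewrite patchE memNset// => /= /andP[t0 tr].
  by move: r0; rewrite ltNge (le_trans t0 (ltW tr)).
rewrite mem_set /=; last by rewrite in_itv/= r0.
transitivity (\int[mu]_(t in `[0%R, r[) (cst (h r) t)).
  rewrite [RHS]integral_mkcond; apply: eq_integral => t _; rewrite !patchE.
  by congr (if _ then _ else _); apply/idP/idP; rewrite !inE /= in_itv.
rewrite integral_cst//= lebesgue_measure_itv/= lte_fin.
case: ltP => [r1|]; first by rewrite oppr0 adde0.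
by move=> r1; have -> : r = 0%R by apply/eqP; rewrite eq_le r0 r1.
Qed.

Lemma integral_id (x : R) : (0 < x)%R -> \int[mu]_(r in `[0%R, x]) r%:E = (x ^+ 2 / 2)%:E.
Proof.
move=> x0.
pose F (r : R) := (r ^+ 2 / 2)%R.
have dF (r : R) : is_derive r 1%R F r.
  rewrite /F; apply: is_derive_eq; rewrite /GRing.scale /=; by field.
have cF : continuous F.
  move=> y; apply: differentiable_continuous; rewrite -derivable1_diffP.
  exact: (@ex_derive _ _ _ _ _ _ _ (dF y)).
rewrite (@continuous_FTC2 _ (fun r => r) F)//.
- by rewrite /F expr0n /= mul0r sube0.
- by apply: continuous_subspaceT => y; exact: cvg_id.
- split; first by move=> r _; exact: (@ex_derive _ _ _ _ _ _ _ (dF r)).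
  + by apply: cvg_at_right_filter; exact: cF.
  + by apply: cvg_at_left_filter; exact: cF.
- by move=> r _; rewrite derive1E; exact: (@derive_val _ _ _ _ _ _ _ (dF r)).
Qed.

(** The image of the plane measure under the modulus and a multiple of [r dr] agree on the rays
    below [x]: the former grows like [x ^+ 2] by scaling, the latter by integration. These rays are
    stable under intersection and generate the Borel sets, so the measures coincide. The factor is
    twice the area of the unit disc. *)
Lemma polar_coordinates : exists2 A : R, (0 < A)%R &
  forall h : RM -> \bar R, measurable_fun setT h -> (forall r, 0 <= h r) ->
  \int[mu2]_u h (cabs (of_plane u)) =
  A%:E * \int[mu]_(r in `[0%R, +oo[) (h r * r%:E).
Proof.
have A0 := disc1_area_gt0; have Aoo := disc1_area_lty.
pose A := fine (mu2 (disc 1)).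
have AE : mu2 (disc 1) = A%:E by rewrite fineK// ge0_fin_numE// ltW.
have A1 : (0 < A)%R by rewrite -lte_fin -AE.
have A2 : (0 <= 2 * A)%R by rewrite mulr_ge0// ltW.
exists (2 * A)%R => [|h mh h0]; first by rewrite mulr_gt0.
pose nu1 := image_measure mu2 measurable_cabs_plane.
pose nuT : {measure set (RM * RM) -> \bar R} := mrestr mu2 measurable_under_diagonal.
pose nu2 : {measure set RM -> \bar R} := mscale (NngNum A2) (image_measure nuT measurable_fst).
have mT := measurable_under_diagonal.
have nuTE (f : RM * RM -> \bar R) : measurable_fun setT f -> (forall u, 0 <= f u) ->
    \int[nuT]_u f u = \int[mu2]_(u in under_diagonal) f u.
  move=> mf f0; have nuTC : nuT (~` under_diagonal) = 0.
    by rewrite /nuT /= /mrestr setICl measure0.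
  rewrite (ge0_negligible_integral (measurableC mT) measurableT mf (fun u _ => f0 u) nuTC).
  rewrite setTD setCK; apply: eq_measure_integral => B mB BD.
  by rewrite /nuT /= /mrestr setIidl.
have nu1E x : nu1 `]-oo, x[%classic = mu2 (disc x).
  rewrite (_ : disc x =
    (fun u : RM * RM => cabs (of_plane u) : RM) @^-1` `]-oo, x[%classic); first by reflexivity.
  by apply/seteqP; split => u /=; rewrite in_itv.
have nu2E x : (0 < x)%R -> nuT (fst @^-1` `]-oo, x[%classic) = (x ^+ 2 / 2)%:E.
  move=> x0; pose k := fun r : RM => (\1_(`]-oo, x[%classic : set RM) r)%:E : \bar R.
  have mk : measurable_fun setT k by apply/measurable_EFinP; apply: measurable_indic.
  have k0 r : 0 <= k r by rewrite lee_fin.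
  transitivity (\int[mu2]_(u in under_diagonal) k u.1).
    rewrite -nuTE//; last by exact: (measurableT_comp mk measurable_fst).
    rewrite (_ : (fun u : RM * RM => k u.1) = (fun u => (\1_(fst @^-1` `]-oo, x[%classic) u)%:E)).
      have mx : measurable (fst @^-1` `]-oo, x[%classic : set (RM * RM)).
        by rewrite -[X in measurable X]setTI; exact: measurable_fst.
      by rewrite (integral_indic _ measurableT mx) setIT.
    by apply/funext => u; rewrite /k !indicE;
      congr ((nat_of_bool _)%:R%:E); apply/idP/idP; rewrite !inE.
  rewrite ge0_integral_under_diagonal// -(integral_id x0) -integral_itv_bndo_bndc//.
  rewrite [LHS]integral_mkcond [RHS]integral_mkcond; apply: eq_integral => r _.
  rewrite !patchE /k indicE.
  have [r0|r0] := leP 0%R r; last first.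
    by rewrite !memNset//= in_itv/= ?andbT leNgt r0.
  have [rx|rx] := ltP r x; last first.
    rewrite (memNset (A := `]-oo, x[%classic)) ?mul0e; last first.
      by rewrite /= in_itv/=; apply/negP; rewrite -leNgt.
    rewrite (memNset (A := `[0%R, x[%classic)); first by case: ifP.
    by rewrite /= in_itv/= r0/=; apply/negP; rewrite -leNgt.
  by rewrite !mem_set/= ?mul1e// in_itv/= ?r0.
have mG : @measurable _ RM = <<s (@RGenInftyO.G R) >> by exact: RGenInftyO.measurableE.
have GI : setI_closed (@RGenInftyO.G R).
  move=> _ _ [x ->] [y ->]; exists (Num.min x y); apply/seteqP; split => z /=.
    by rewrite !in_itv/= lt_min => -[-> ->].
  by rewrite !in_itv/= lt_min => /andP.
have Gn (n : nat) : @RGenInftyO.G R `]-oo, n%:R[%classic by exists n%:R.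
have Gc : \bigcup_(n : nat) (`]-oo, n%:R[%classic : set R) = setT.
  apply/seteqP; split => // x _; exists (Num.truncn x).+1 => //=.
  by rewrite in_itv/= truncnS_gt.
have disc_le0 (x : R) : (x <= 0)%R -> disc x = set0.
  move=> x0; apply/seteqP; split => // u; rewrite /disc /mkset => ux.
  by have := cabs_ge0 (of_plane u); rewrite leNgt (lt_le_trans ux).
have nu12 B : @RGenInftyO.G R B -> nu1 B = nu2 B.
  move=> [x ->]; rewrite nu1E.
  have -> : nu2 `]-oo, x[%classic = (2 * A)%:E * nuT (fst @^-1` `]-oo, x[%classic) by [].
  have [x0|x0] := ltP 0%R x.
    by rewrite nu2E// disc_area// AE -!EFinM; congr EFin; field.
  rewrite disc_le0// measure0 [X in nuT X](_ : _ =
     ~` under_diagonal `&` (fst @^-1` `]-oo, x[%classic)); last first.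
    apply/esym/setIidr => u /=; rewrite in_itv/= => ux /andP[u0 uu].
    by move: ux; rewrite ltNge (le_trans x0)// (le_trans u0 (ltW uu)).
  by rewrite /nuT /= /mrestr setIAC setICl set0I measure0 mule0.
have nu1_fin k : nu1 `]-oo, k%:R[%classic < +oo.
  rewrite nu1E; case: k => [|k]; first by rewrite disc_le0// measure0.
  by rewrite disc_area// AE -EFinM ltry.
have E B : measurable B -> nu1 B = nu2 B.
  exact: (@measure_unique _ R RM _ _ mG GI Gn Gc nu1 nu2 nu12 nu1_fin).
rewrite -(ge0_integral_image_measure mu2 measurable_cabs_plane mh h0).
transitivity (\int[nu2]_x h x).
  by apply: eq_measure_integral => B mB _; exact: E.
rewrite ge0_integral_mscale// ge0_integral_image_measure//.
rewrite nuTE//; first by rewrite ge0_integral_under_diagonal.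
exact: (measurableT_comp mh measurable_fst).
Qed.

End plane_polar.

(** * Integrability of powers of [1 - r] *)

Section disc_measure.
Context {R : realType}.
Local Notation RM := (measurableTypeR R).
Local Notation mu := (@lebesgue_measure R).
Local Open Scope ereal_scope.

Lemma is_derive_onem (r : R) : is_derive r 1%R (fun r : R => 1 - r)%R (- 1)%R.
Proof. by apply: is_derive_eq; rewrite add0r mul1r. Qed.

Lemma onem_powR_continuous (c b : R) : (b < 1)%R ->
  {within `[0%R, b], continuous (fun r : R => (1 - r) `^ c)%R}.
Proof.
move=> b1; apply: derivable_within_continuous => r; rewrite in_itv/= => /andP[r0 rb].
have r1 : (0 < 1 - r)%R by lra.
have d1 : is_derive (1 - r)%R 1%R (@powR R ^~ c) (c * (1 - r) `^ (c - 1))%R.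
  exact: is_derive1_powR.
have d2 : is_derive r 1%R (fun r : R => 1 - r)%R (- 1)%R by exact: is_derive_onem.
by have [] := @is_derive1_comp R (@powR R ^~ c) (fun r : R => 1 - r)%R _ _ _ d1 d2.
Qed.

(** On [[0, b n]] with [b n] increasing to 1, the antiderivative [F] bounds the integral by the
    inverse of [1 - g]; monotone convergence does the rest. *)
Lemma onem_powR_integral_lty (g : R) : (g < 1)%R ->
  \int[mu]_(r in `[0%R, 1%R[) ((1 - r) `^ (- g))%:E < +oo.
Proof.
move=> g1; have g0 : (0 < 1 - g)%R by rewrite subr_gt0.
pose F (r : R) := (- (1 - g)^-1 * (1 - r) `^ (1 - g))%R.
have dF (r : R) : (r < 1)%R -> is_derive r 1%R F ((1 - r) `^ (- g))%R.
  move=> r1; have r1' : (0 < 1 - r)%R by rewrite subr_gt0.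
  have d1 := @is_derive1_powR R (1 - g) _ r1'.
  have d2 : is_derive r 1%R (fun r : R => 1 - r)%R (- 1)%R by exact: is_derive_onem.
  have d3 := @is_derive1_comp R (@powR R ^~ (1 - g)%R) (fun r : R => 1 - r)%R _ _ _ d1 d2.
  have -> : F = (- (1 - g)^-1 \*: ((@powR R ^~ (1 - g)%R) \o (fun r : R => 1 - r)))%R by [].
  apply: is_derive_eq; rewrite /GRing.scale /=.
  have -> : (1 - g - 1 = - g)%R by ring.
  by field; rewrite gt_eqF.
pose b n : R := (1 - n.+1%:R^-1)%R.
have bn n : (0 <= b n < 1)%R.
  rewrite /b subr_ge0 invf_le1 ?ler1n//= gtrBl invr_gt0 ltr0n//.
have le_b n : \int[mu]_(r in `[0%R, b n]) ((1 - r) `^ (- g))%:E <= ((1 - g)^-1)%:E.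
  have /andP[b0 b1] := bn n.
  move: b0; rewrite le_eqVlt => /predU1P[<-|b0].
    by rewrite set_itv1 integral_set1 lee_fin invr_ge0 ltW.
  rewrite (@continuous_FTC2 _ (fun r => (1 - r) `^ (- g))%R F)//.
  - rewrite -EFinB lee_fin /F subr0 powR1 mulr1 opprK gerDr.
    by rewrite mulNr oppr_le0 mulr_ge0 ?powR_ge0// invr_ge0 ltW.
  - exact: onem_powR_continuous.
  - have cF r : (r < 1)%R -> {for r, continuous F}.
      move=> r1; apply: differentiable_continuous; rewrite -derivable1_diffP.
      exact: (@ex_derive _ _ _ _ _ _ _ (dF r r1)).
    split.
    + move=> r; rewrite in_itv/= => /andP[_ rb].
      exact: (@ex_derive _ _ _ _ _ _ _ (dF r (lt_trans rb b1))).
    + by apply: cvg_at_right_filter; exact: cF.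
    + by apply: cvg_at_left_filter; exact: cF.
  - move=> r; rewrite in_itv/= => /andP[_ rb]; rewrite derive1E.
    exact: (@derive_val _ _ _ _ _ _ _ (dF r (lt_trans rb b1))).
have UE : (`[0%R, 1%R[%classic : set RM) = \bigcup_n (`[0%R, b n]%classic : set RM).
  apply/seteqP; split => r /=; rewrite ?in_itv/=.
    move=> /andP[r0 r1]; exists (Num.truncn (1 - r)^-1) => //=.
    rewrite in_itv/= r0/= /b lerBrDl -lerBrDr -[leRHS]invrK lef_pV2 ?posrE ?invr_gt0 ?subr_gt0//.
    by rewrite ltW// truncnS_gt.
  move=> [n _ /=]; rewrite in_itv/= => /andP[-> rb] /=.
  by rewrite (le_lt_trans rb)//; have /andP[] := bn n.
have mf : measurable_fun setT (fun r : RM => ((1 - r) `^ (- g))%:E : \bar R).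
  apply/measurable_EFinP; apply: (measurableT_comp (measurable_powR _)).
  by apply: measurable_funB.
have nb : nondecreasing_seq (fun n => `[0%R, b n]%classic : set RM).
  move=> m n mn; apply/subsetPset => r /=; rewrite !in_itv/= => /andP[-> rb]/=.
  by rewrite (le_trans rb)// /b lerD2l lerN2 lef_pV2 ?posrE ?ltr0n// ler_nat.
have mb n : measurable (`[0%R, b n]%classic : set RM) by [].
have mfb n : measurable_fun (`[0%R, b n]%classic : set RM)
    (fun r : RM => ((1 - r) `^ (- g))%:E : \bar R).
  exact: measurable_funTS.
have f0 (n : nat) (r : RM) : (`[0%R, b n]%classic : set RM) r -> 0 <= ((1 - r) `^ (- g))%:E.
  by move=> _; rewrite lee_fin powR_ge0.
have H := @ge0_nondecreasing_set_cvg_integral _ RM R _ _ mu nb mb mfb f0.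
rewrite UE; apply: le_lt_trans (ltry (1 - g)^-1).
rewrite -(cvg_lim _ H)//; apply: lime_le; first exact: cvgP H.
exact: nearW.
Qed.

End disc_measure.

(** * The area measure of the disc *)

Section area_measure.
Context {R : realType}.
Local Notation RM := (measurableTypeR R).
Local Notation mu := (@lebesgue_measure R).
Local Notation mu2 := (mu \x mu)%E.
Local Notation D := (@plane_disc R).
Local Open Scope ereal_scope.

Lemma measurable_plane_disc : measurable (D : set (RM * RM)).
Proof. exact: measurable_disc. Qed.

Lemma ge0_integral_dA (F : RM * RM -> \bar R) : measurable_fun (D : set (RM * RM)) F ->
  (forall u, D u -> 0 <= F u) ->
  \int[@dA R]_(u in D) F u = (pi^-1)%:E * \int[mu2]_u (F \_ D) u.
Proof.
move=> mF F0; rewrite /dA ge0_integral_mscale//; last exact: measurable_plane_disc.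
by rewrite integral_mkcond.
Qed.

Lemma dA_polar : exists2 A : R, (0 < A)%R &
  forall h : RM -> \bar R, measurable_fun (`[0%R, 1%R[%classic : set RM) h ->
  (forall r, (0 <= r < 1)%R -> 0 <= h r) ->
  \int[@dA R]_(u in D) h (cabs (of_plane u)) =
  A%:E * \int[mu]_(r in `[0%R, 1%R[) (h r * r%:E).
Proof.
have [A A0 hA] := @polar_coordinates R.
exists (pi^-1 * A)%R => [|h mh h0]; first by rewrite mulr_gt0// invr_gt0 pi_gt0.
pose k := h \_ (`[0%R, 1%R[%classic : set RM).
have mI : measurable (`[0%R, 1%R[%classic : set RM) by [].
have mk : measurable_fun setT k by exact/(measurable_restrictT _ mI).
have k0 r : 0 <= k r by apply: erestrict_ge0 => {}r /=; rewrite in_itv/=; exact: h0.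
have kE : ((fun u : RM * RM => h (cabs (of_plane u))) \_ D) = (fun u => k (cabs (of_plane u))).
  apply/funext => u; rewrite /k !patchE; congr (if _ then _ else _).
  by apply/idP/idP; rewrite !inE /= in_itv/= cabs_ge0.
have mhD : measurable_fun (D : set (RM * RM)) (fun u : RM * RM => h (cabs (of_plane u))).
  apply/(measurable_restrictT _ measurable_plane_disc); rewrite kE.
  exact: (measurableT_comp mk measurable_cabs_plane).
rewrite ge0_integral_dA//; last first.
  by move=> u uD; apply: h0; rewrite cabs_ge0.
rewrite kE hA// EFinM -muleA; congr (_ * (_ * _)).
rewrite [LHS]integral_mkcond [RHS]integral_mkcond; apply: eq_integral => r _.
rewrite /k !patchE; have [r0|r0] := leP 0%R r; last first.
  by rewrite !memNset//= in_itv/= ?andbT leNgt r0.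
rewrite (mem_set (A := `[0%R, +oo[%classic)); last by rewrite /= in_itv/= r0.
by case: ifP; rewrite ?mul0e.
Qed.

Definition rotate (z : cplx R) (u : RM * RM) : RM * RM :=
  (complex.Re (of_plane u * z)%R, complex.Im (of_plane u * z)%R).

Lemma of_plane_rotate z u : of_plane (rotate z u) = (of_plane u * z)%R.
Proof. by rewrite /rotate /of_plane; case: (_ * z)%R. Qed.

Lemma measurable_rotate z : measurable_fun setT (rotate z).
Proof.
case: z => c s; apply: measurable_pair_fun.
  have := @measurable_lin R c (- s)%R; congr measurable_fun; apply/funext => -[x y] /=; ring.
have := @measurable_lin R s c; congr measurable_fun; apply/funext => -[x y] /=; ring.
Qed.

Lemma rotate_restrict (F : cplx R -> \bar R) z : cabs z = 1%R ->
  (fun u => F (of_plane u * z)%R) \_ D = (((fun u => F (of_plane u)) \_ D) \o rotate z).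
Proof.
move=> z1; apply/funext => u; rewrite /= !patchE of_plane_rotate.
congr (if _ then _ else _); apply/idP/idP; rewrite !inE /plane_disc /unit_disc /preimage /mkset;
  by rewrite of_plane_rotate cabsM z1 mulr1.
Qed.

Lemma measurable_rotated (F : cplx R -> \bar R) z : cabs z = 1%R ->
  measurable_fun (D : set (RM * RM)) (fun u => F (of_plane u)) ->
  measurable_fun (D : set (RM * RM)) (fun u => F (of_plane u * z)%R).
Proof.
move=> z1 /(measurable_restrictT _ measurable_plane_disc) mF.
apply/(measurable_restrictT _ measurable_plane_disc).
by rewrite rotate_restrict//; exact: (measurableT_comp mF (measurable_rotate z)).
Qed.

Lemma dA_rotation (F : cplx R -> \bar R) z : cabs z = 1%R ->
  measurable_fun (D : set (RM * RM)) (fun u => F (of_plane u)) ->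
  (forall x, unit_disc x -> 0 <= F x) ->
  \int[@dA R]_(u in D) F (of_plane u * z)%R = \int[@dA R]_(u in D) F (of_plane u).
Proof.
move=> z1 mF F0.
rewrite !ge0_integral_dA//; last 3 first.
- by move=> u uD; exact: F0.
- exact: measurable_rotated.
- by move=> u uD; apply: F0; rewrite /unit_disc /mkset cabsM z1 mulr1.
congr (_ * _); rewrite rotate_restrict//.
rewrite -(@ge0_integral_rotation R ((fun u => F (of_plane u)) \_ D) z z1)//.
  exact/(measurable_restrictT _ measurable_plane_disc).
by move=> u; apply: erestrict_ge0 => {}u uD; exact: F0.
Qed.

End area_measure.

(** * Coefficient estimates *)

Section coefficient_bound.
Context {R : realType}.
Local Notation RM := (measurableTypeR R).
Local Notation D := (@plane_disc R : set (RM * RM)).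

(** On the disc the modulus of [f] is the pointwise limit of the moduli of partial sums, whose real
    and imaginary parts ([mC]) are polynomials in the coordinates. *)
Lemma measurable_power_series (c : nat -> cplx R) (f : cplx R -> cplx R) :
  has_power_series 0 1 c f ->
  measurable_fun D (fun u => cabs (f (of_plane u)) : RM).
Proof.
move=> hf.
pose mC (g : RM * RM -> cplx R) :=
  measurable_fun setT (fun u => complex.Re (g u) : RM) /\
  measurable_fun setT (fun u => complex.Im (g u) : RM).
have mCM g h : mC g -> mC h -> mC (fun u => g u * h u).
  move=> [g1 g2] [h1 h2]; split.
    rewrite (_ : (fun _ => _) = (fun u => complex.Re (g u) * complex.Re (h u)
       - complex.Im (g u) * complex.Im (h u) : RM)).
      by apply: measurable_funB; apply: measurable_funM.
    by apply/funext => u; case: (g u) (h u) => [? ?] [? ?].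
  rewrite (_ : (fun _ => _) = (fun u => complex.Re (g u) * complex.Im (h u)
     + complex.Im (g u) * complex.Re (h u) : RM)).
    by apply: measurable_funD; apply: measurable_funM.
  by apply/funext => u; case: (g u) (h u) => [? ?] [? ?].
have mCc (a : cplx R) : mC (fun=> a) by split; exact: measurable_cst.
have mCX n : mC (fun u => of_plane u ^+ n).
  elim: n => [|n IH]; first by under eq_fun do rewrite expr0.
  under eq_fun do rewrite exprS; apply: mCM => //.
  by split => /=; [exact: measurable_fst|exact: measurable_snd].
have mCS n : mC (fun u => series (fun k => c k * of_plane u ^+ k) n).
  elim: n => [|n [IH1 IH2]].
    by rewrite /series /=; under eq_fun do rewrite big_geq//.
  have [h1 h2] := mCM _ _ (mCc (c n)) (mCX n).
  split.
    rewrite (_ : (fun _ => _) = (fun u =>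
      complex.Re (series (fun k => c k * of_plane u ^+ k) n) +
        complex.Re (c n * of_plane u ^+ n) : RM)).
      exact: measurable_funD.
    apply/funext => u; rewrite seriesSr /=.
    by case: (series _ n) (_ * _) => [? ?] [? ?].
  rewrite (_ : (fun _ => _) = (fun u =>
    complex.Im (series (fun k => c k * of_plane u ^+ k) n) +
      complex.Im (c n * of_plane u ^+ n) : RM)).
    exact: measurable_funD.
  apply/funext => u; rewrite seriesSr /=.
  by case: (series _ n) (_ * _) => [? ?] [? ?].
apply: (@measurable_fun_cvg _ _ _ D (fun n u => cabs (series (fun k => c k * of_plane u ^+ k) n))).
  move=> n; apply: measurable_funTS; have [h1 h2] := mCS n.
  have := measurableT_comp (@measurable_cabs_plane R) (measurable_pair_fun h1 h2).
  congr measurable_fun; apply/funext => u /=; congr cabs.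
  by rewrite /of_plane /=; case: (series _ n).
move=> u uD; apply: cvg_cabs.
have := hf (of_plane u); rewrite subr0; apply; exact: uD.
Qed.

Lemma measurable_radial (h : RM -> \bar R) : measurable_fun (`[0%R, 1%R[%classic : set RM) h ->
  measurable_fun D (fun u => h (cabs (of_plane u))).
Proof.
move=> mh; have mI : measurable (`[0%R, 1%R[%classic : set RM) by [].
apply/(measurable_restrictT _ (@measurable_plane_disc R)).
rewrite (_ : _ \_ _ = (h \_ (`[0%R, 1%R[%classic : set RM)) \o (fun u => cabs (of_plane u))).
  apply: (measurableT_comp _ (@measurable_cabs_plane R)).
  exact/(measurable_restrictT _ mI).
apply/funext => u; rewrite /= !patchE; congr (if _ then _ else _).
by apply/idP/idP; rewrite !inE /= in_itv/= cabs_ge0.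
Qed.

(** Induction from two-point convexity: the mean of [N.+2] values combines that of the first [N.+1]
    with the last one, with weight [N.+1 / N.+2] on the former. *)
Lemma power_mean (p : R) (a : nat -> R) (N : nat) : 1 <= p -> (forall k, 0 <= a k) ->
  (N.+1%:R^-1 * \sum_(0 <= k < N.+1) a k) `^ p <=
  N.+1%:R^-1 * \sum_(0 <= k < N.+1) a k `^ p.
Proof.
move=> p1 a0; elim: N => [|N IH]; first by rewrite !big_nat1 invr1 !mul1r.
have S0 : 0 <= N.+1%:R^-1 * \sum_(0 <= k < N.+1) a k.
  by rewrite mulr_ge0 ?invr_ge0// sumr_ge0.
have t01 : 0 <= (N.+1%:R / N.+2%:R : R) <= 1.
  by rewrite divr_ge0//= ler_pdivrMr ?ltr0n// mul1r ler_nat.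
have /andP[t0 t1] := t01.
have := @convex_powR R p p1 (Itv01 t0 t1) (N.+1%:R^-1 * \sum_(0 <= k < N.+1) a k) (a N.+1).
rewrite !inE /= !in_itv/= !andbT => /(_ S0 (a0 _)).
rewrite !convRE /= /unstable.onem => H.
have N2 : N.+2%:R != 0 :> R by rewrite pnatr_eq0.
have N1 : N.+1%:R != 0 :> R by rewrite pnatr_eq0.
have E (x y : R) : N.+2%:R^-1 * (x + y) =
   N.+1%:R / N.+2%:R * (N.+1%:R^-1 * x) + (1 - N.+1%:R / N.+2%:R) * y.
  have -> : 1 - N.+1%:R / N.+2%:R = N.+2%:R^-1 :> R.
    apply: (mulIf N2); rewrite mulrBl mul1r divfK// mulVf//.
    by rewrite -[N.+2%:R]natr1 addrAC subrr add0r.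
  by rewrite mulrDr; congr (_ + _); rewrite [RHS]mulrA; congr (_ * x); rewrite mulrAC divff// mul1r.
rewrite (big_nat_recr N.+1)// (big_nat_recr N.+1)//= !E.
apply: le_trans H _; rewrite lerD2r ler_wpM2l//.
Qed.

Lemma powR_cvg (p l : R) (u : nat -> R) : 1 <= p -> 0 <= l -> (forall n, 0 <= u n) ->
  u @ \oo --> l -> (u n `^ p) @[n --> \oo] --> l `^ p.
Proof.
move=> p1 l0 u0 ul; have p0 : 0 < p := lt_le_trans ltr01 p1.
move: l0; rewrite le_eqVlt => /predU1P[l0|l0]; last first.
  suff cp : {for l, continuous (@powR R ^~ p)} by exact: continuous_cvg cp ul.
  apply: differentiable_continuous; rewrite -derivable1_diffP.
  exact: (@ex_derive _ _ _ _ _ _ _ (is_derive1_powR p l0)).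
(* At the limit 0 the derivative argument is replaced by squeezing: a number in [[0, 1[] is at least
   its [p]-th power. *)
rewrite -l0 powR0 ?gt_eqF//.
apply: (@squeeze_cvgr _ _ _ _ (fun=> 0) u); last by rewrite l0.
  have : \forall n \near \oo, u n < 1 by apply: cvgr_lt ul _ _; rewrite -l0.
  apply: filterS => n un1; rewrite powR_ge0/=.
  have := u0 n; rewrite le_eqVlt => /predU1P[<-|un0]; first by rewrite powR0// gt_eqF.
  by rewrite ge1r_powR// un0 ltW.
exact: cvg_cst.
Qed.

(* Rotation averages of [f] converge to the monomial [lambda n z^n]; Fatou's
   lemma, the power mean inequality and rotation invariance then compare the
   monomial with [f] itself. *)
Lemma monomial_le_bergman (p : R) (phi : cplx R -> R) (lambda : nat -> cplx R)
    (f : cplx R -> cplx R) (n : nat) :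
  1 <= p -> radial phi -> (forall z, unit_disc z -> 0 <= phi z) ->
  measurable_fun (`[0, 1[%classic : set RM) (profile phi) ->
  has_power_series 0 1 lambda f ->
  (\int[@dA R]_(u in D) (cabs (lambda n * of_plane u ^+ n) `^ p * phi (of_plane u))%:E
   <= bergman_integral p phi f)%E.
Proof.
move=> p1 rphi phi0 mprof hf; have p0 : 0 < p := lt_le_trans ltr01 p1.
have mD := @measurable_plane_disc R.
have mphi : measurable_fun D (fun u => phi (of_plane u) : RM).
  have /measurable_EFinP := mprof => /measurable_radial /measurable_EFinP.
  apply: eq_measurable_fun => u; rewrite inE => uD.
  by rewrite /profile -rphi.
have mprod (g : RM * RM -> R) : measurable_fun D (g : RM * RM -> RM) ->
    measurable_fun D (fun u => (g u `^ p * phi (of_plane u))%:E).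
  move=> mg; apply/measurable_EFinP; apply: measurable_funM => //.
  exact: (measurableT_comp (measurable_powR p)).
pose F (z : cplx R) : \bar R := (cabs (f z) `^ p * phi z)%:E.
have mF : measurable_fun D (fun u => F (of_plane u)).
  by apply: mprod; exact: (measurable_power_series hf).
have F0 z : unit_disc z -> (0 <= F z)%E.
  by move=> z1; rewrite lee_fin mulr_ge0 ?powR_ge0 ?phi0.
have /choice[w wN] : forall N : nat, exists w : cplx R, N.+1.-primitive_root w.
  by move=> N; exact: primitive_root_exists.
pose av N u := cabs (root_average f N.+1 n (w N) (of_plane u)).
pose mean N (u : RM * RM) := N.+1%:R^-1 *
  \sum_(0 <= k < N.+1) cabs (f (of_plane u * w N ^+ k)).
have wk1 N k : cabs (w N ^+ k) = 1.
  by rewrite cabsX (primitive_root_cabs (wN N)) expr1n.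
have av_mean N u : av N u <= mean N u.
  rewrite /av /root_average cabsM cabsV cabs_nat ler_wpM2l ?invr_ge0//.
  apply: le_trans (cabs_sum _ _ _) _; apply: ler_sum => k _.
  by rewrite cabsM (cabsX (w N ^+ k)) wk1 expr1n mulr1.
have mfw N k : measurable_fun D (fun u => cabs (f (of_plane u * w N ^+ k)) : RM).
  have /measurable_EFinP := measurable_power_series hf => h.
  by have /measurable_EFinP := measurable_rotated (F := fun z => (cabs (f z))%:E) (wk1 N k) h.
have mmean N : measurable_fun D (mean N : _ -> RM).
  apply: measurable_funM; first exact: measurable_cst.
  by apply: measurable_sum => k; exact: mfw.
pose G N u := (mean N u `^ p * phi (of_plane u))%:E.
have mean0 N u : 0 <= mean N u.
  by rewrite mulr_ge0 ?invr_ge0// sumr_ge0// => k _; exact: cabs_ge0.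
have G_le N : (\int[@dA R]_(u in D) G N u <= bergman_integral p phi f)%E.
  have N1 : 0 <= N.+1%:R^-1 :> R by rewrite invr_ge0.
  (* The power mean inequality holds pointwise and [phi], being radial, does not see the rotations;
     each of the [N.+1] rotated integrals then equals that of [f]. *)
  apply: (@le_trans _ _ (\int[@dA R]_(u in D)
     ((N.+1%:R^-1)%:E * \sum_(0 <= k < N.+1) F (of_plane u * w N ^+ k)%R))%E).
    apply: ge0_le_integral => //.
    - by move=> u uD; rewrite lee_fin mulr_ge0 ?powR_ge0 ?phi0.
    - exact: mprod.
    - apply: emeasurable_funM; first exact: measurable_cst.
      apply: emeasurable_sum => k; exact: measurable_rotated.
    - move=> u uD; rewrite /F.
      have phiw k : phi (of_plane u * w N ^+ k) = phi (of_plane u).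
        have uw : unit_disc (of_plane u * w N ^+ k).
          by rewrite /unit_disc /mkset cabsM wk1 mulr1.
        by rewrite (rphi _ uw) (rphi _ uD) cabsM wk1 mulr1.
      under eq_bigr do rewrite phiw.
      rewrite sumEFin -EFinM lee_fin -mulr_suml mulrA ler_wpM2r ?phi0//.
      by apply: power_mean => // k; exact: cabs_ge0.
  have F0k u k : D u -> (0 <= F (of_plane u * w N ^+ k)%R)%E.
    by move=> uD; apply: F0; rewrite /unit_disc /mkset cabsM wk1 mulr1.
  have mFk k : measurable_fun D (fun u => F (of_plane u * w N ^+ k)%R).
    exact: measurable_rotated.
  rewrite ge0_integralZl//; last 2 first.
  - by apply: emeasurable_sum => k; exact: mFk.
  - by move=> u uD; apply: sume_ge0 => k _; exact: F0k.
  rewrite ge0_integral_sum//; last by move=> k u uD; exact: F0k.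
  under eq_bigr do rewrite dA_rotation//.
  have sum_cst (B : \bar R) M : (\sum_(0 <= k < M) B = M%:R%:E * B)%E.
    elim: M => [|M IH]; first by rewrite big_geq// mul0e.
    by rewrite big_nat_recr//= IH -natr1 EFinD ge0_muleDl ?lee_fin// mul1e.
  by rewrite sum_cst muleA -EFinM mulVf ?pnatr_eq0// mul1e.
(* Fatou's lemma is applied to the means [G], which dominate the root averages; only the latter are
   known to converge, so the limit is compared with a lower limit. *)
apply: (@le_trans _ _ (\int[@dA R]_(u in D) limn_einf (G ^~ u))%E).
  apply: ge0_le_integral => //.
  - by move=> u uD; rewrite lee_fin mulr_ge0 ?powR_ge0 ?phi0.
  - apply: mprod.
    rewrite (_ : (fun _ => _) = (fun u => cabs (lambda n) * cabs (of_plane u) ^+ n)).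
      apply: measurable_funM => //; apply: measurable_funX.
      by apply: measurable_funTS; exact: measurable_cabs_plane.
    by apply/funext => u; rewrite cabsM cabsX.
  - apply: measurableT_comp => //.
    apply: (@measurable_fun_limn_esup _ _ _ _ (fun N u => - G N u)%E) => N.
    by apply: measurableT_comp => //; exact: mprod.
  - move=> u uD; pose H N := (av N u `^ p * phi (of_plane u))%:E.
    have uD' : cabs (of_plane u) < 1 by exact: uD.
    have bl : bsum (fun k => cabs (lambda k) * cabs (of_plane u) ^+ k).
      by apply: (power_series_bsum hf); rewrite cabs_ge0 uD'.
    have [T [T0 hT]] := root_average_cvg (cabs_ge0 _) bl.
    have av_cvg : av N u @[N --> \oo] --> cabs (lambda n * of_plane u ^+ n).
      apply: cvg_cabs; apply/cvg_cabsP.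
      apply: (@squeeze_cvgr _ _ _ _ (fun=> 0) (fun N => T N.+1)).
      - exists n => // N /= nN; rewrite cabs_ge0/=.
        apply: hT => // x xu; have := hf x; rewrite subr0; apply.
        by rewrite xu.
      - exact: cvg_cst.
      - by move: T0; rewrite -cvg_shiftS.
    have H_cvg : H N @[N --> \oo] -->
        (cabs (lambda n * of_plane u ^+ n) `^ p * phi (of_plane u))%:E.
      apply: cvg_EFin; first exact: nearW.
      apply: cvgM; last exact: cvg_cst.
      by apply: powR_cvg => // *; exact: cabs_ge0.
    rewrite -(cvg_lim _ H_cvg)// -(is_cvg_limn_einfE (cvgP _ H_cvg)).
    rewrite !limn_einf_lim; apply: lee_lim; [exact: is_cvg_einfs|exact: is_cvg_einfs|].
    apply: nearW => N; apply: le_ereal_inf_tmp => _ [k kN <-].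
    apply: ge_ereal_inf; exists (H k); first by exists k.
    rewrite lee_fin ler_wpM2r ?phi0// ge0_ler_powR ?nnegrE ?cabs_ge0//.
    exact: ltW.
apply: le_trans; first apply: fatou => //.
- by move=> N; exact: mprod.
- by move=> N u uD; rewrite lee_fin mulr_ge0 ?powR_ge0 ?phi0.
rewrite limn_einf_lim; apply: lime_le; first exact: is_cvg_einfs.
apply: nearW => N; apply: le_trans (G_le N).
by apply: ereal_inf_lbound; exists N => /=.
Qed.

End coefficient_bound.

(** * A boundedness criterion *)

Section criterion.
Context {R : realType}.
Local Notation RM := (measurableTypeR R).
Local Notation mu := (@lebesgue_measure R).
Local Notation D := (@plane_disc R : set (RM * RM)).

(** The factor [r] is the Jacobian of polar coordinates, which explains the exponent [n * p + 1] of
    the moments. *)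
Lemma power_weight (p r : R) (n : nat) : 1 <= p -> 0 <= r ->
  (r ^+ n) `^ p * r = r `^ (n%:R * p + 1).
Proof.
move=> p1 r0; have e0 : n%:R * p + 1 != 0.
  by rewrite gt_eqF// ltr_wpDl// mulr_ge0// (le_trans ler01).
rewrite powRD ?(negbTE e0)// powRr1//; congr (_ * _).
by rewrite powRrM powR_mulrn.
Qed.

Lemma coefficient_moment_bound : exists2 A : R, 0 < A &
  forall (p : R) (phi : cplx R -> R) (lambda : nat -> cplx R)
    (f : cplx R -> cplx R) (n : nat),
  1 <= p -> radial phi -> (forall z, unit_disc z -> 0 < phi z) ->
  measurable_fun (`[0, 1[%classic : set RM) (profile phi) ->
  has_power_series 0 1 lambda f ->
  ((A * cabs (lambda n) `^ p)%:E *
   \int[mu]_(r in `[0%R, 1%R[) (r `^ (n%:R * p + 1) * profile phi r)%:E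
   <= bergman_integral p phi f)%E.
Proof.
have [A A0 hA] := @dA_polar R; exists A => // p phi lambda f n p1 rphi phi0 mprof hf.
have mI : measurable (`[0%R, 1%R[%classic : set RM) by [].
have prof0 r : 0 <= r < 1 -> 0 <= profile phi r.
  move=> /andP[r0 r1]; apply/ltW/phi0.
  by rewrite /unit_disc /mkset cabsR ger0_norm.
apply: le_trans (monomial_le_bergman n p1 rphi (fun z hz => ltW (phi0 z hz)) mprof hf).
pose h (r : RM) : \bar R := (cabs (lambda n) `^ p * ((r ^+ n) `^ p * profile phi r))%:E.
have mpow (e : R) : measurable_fun (`[0%R, 1%R[%classic : set RM) (fun r : RM => r `^ e : RM).
  by apply: measurable_funTS; exact: measurable_powR.
have mh : measurable_fun (`[0%R, 1%R[%classic : set RM) h.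
  apply/measurable_EFinP; apply: measurable_funM; first exact: measurable_cst.
  apply: measurable_funM => //.
  apply: (measurableT_comp (measurable_powR p)); apply: measurable_funX.
  exact: measurable_id.
have -> : (\int[@dA R]_(u in D) (cabs (lambda n * of_plane u ^+ n) `^ p * phi (of_plane u))%:E
    = \int[@dA R]_(u in D) h (cabs (of_plane u)))%E.
  apply: eq_integral => u; rewrite inE => uD; congr EFin.
  rewrite /h mulrA /profile -rphi//; congr (_ * _).
  by rewrite cabsM cabsX powRM ?cabs_ge0 ?exprn_ge0 ?cabs_ge0.
rewrite hA//; last first.
  by move=> r r01; rewrite lee_fin !mulr_ge0 ?powR_ge0 ?prof0.
rewrite EFinM -muleA lee_pmul2l// -?ge0_integralZl//; last 3 first.
- by apply/measurable_EFinP; apply: measurable_funM => //; exact: mpow.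
- by move=> r; rewrite /= in_itv/= => r01; rewrite lee_fin mulr_ge0 ?powR_ge0 ?prof0.
- by rewrite lee_fin powR_ge0.
rewrite le_eqVlt; apply/orP; left; apply/eqP; apply: eq_integral => r.
rewrite inE /= in_itv/= => /andP[r0 r1].
rewrite /h -!EFinM -power_weight//; congr EFin; ring.
Qed.

Lemma disc_powR_integrable (t : R) : t < 1 ->
  (\int[@dA R]_(u in D) ((1 - cabs (of_plane u)) `^ (- t))%:E < +oo)%E.
Proof.
move=> t1; have [A A0 hA] := @dA_polar R.
have mh (I : set RM) : measurable_fun I (fun r : RM => (1 - r) `^ (- t) : RM).
  apply: measurable_funTS; apply: (measurableT_comp (measurable_powR _)).
  by apply: measurable_funB.
rewrite (hA (fun r => ((1 - r) `^ (- t))%:E)); last 2 first.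
- by apply/measurable_EFinP; exact: mh.
- by move=> r _; rewrite lee_fin powR_ge0.
apply: lte_mul_pinfty => //; first by rewrite lee_fin ltW.
apply: le_lt_trans (onem_powR_integral_lty t1).
apply: ge0_le_integral => //.
- move=> r /=; rewrite in_itv/= => /andP[r0 _].
  by rewrite lee_fin mulr_ge0 ?powR_ge0.
- apply: emeasurable_funM; first by apply/measurable_EFinP; exact: mh.
  by apply/measurable_EFinP; exact: measurable_id.
- by apply/measurable_EFinP; exact: mh.
move=> r /=; rewrite in_itv/= => /andP[r0 r1].
by rewrite lee_fin ler_piMr ?powR_ge0// ltW.
Qed.

(* [kappa n] dominates, up to a constant, the norm of the [n]-th coefficient
   functional, so the hypothesis on partial sums bounds [M_w f] pointwise. *)
Lemma multiplier_bounded_criterion (w : nat -> cplx R) (p : R)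
    (phi : cplx R -> R) (kappa : nat -> R) (K0 C t : R) :
  w 0%N = 0 -> 1 <= p -> radial phi -> (forall z, unit_disc z -> 0 < phi z) ->
  measurable_fun (`[0, 1[%classic : set RM) (profile phi) ->
  (forall n, 0 <= kappa n) -> 0 < K0 ->
  (forall n, (0 < n)%N -> (1 <= (K0 * kappa n `^ p)%:E *
    \int[mu]_(r in `[0%R, 1%R[) (r `^ (n%:R * p + 1) * profile phi r)%:E)%E) ->
  t < p^-1 -> 0 < C ->
  (forall r n, 0 < r < 1 ->
     profile phi r `^ p^-1 * \sum_(0 <= k < n) cabs (w k) * kappa k * r ^+ k
     <= C * (1 - r) `^ (- t)) ->
  multiplier_bounded w p phi.
Proof.
move=> w0 p1 rphi phi0 mprof kappa0 K00 hmom tp C0 hsum.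
have p0 : 0 < p := lt_le_trans ltr01 p1.
have [A A0 hA] := coefficient_moment_bound.
have tp1 : t * p < 1 by rewrite -ltr_pdivlMr// div1r.
(* The first factor comes from the coefficient bound, [C] from the hypothesis on the sums;
   integrating the pointwise bound contributes [I]. *)
pose c1 := (K0 / A) `^ p^-1 * C.
pose I := (\int[@dA R]_(u in D) ((1 - cabs (of_plane u)) `^ (- (t * p)))%:E)%E.
have I_lty : (I < +oo)%E := disc_powR_integrable tp1.
have I0 : (0 <= I)%E by apply: integral_ge0 => u _; rewrite lee_fin powR_ge0.
exists (c1 * fine I `^ p^-1) => f [af fB].
have B0 : (0 <= bergman_integral p phi f)%E.
  apply: integral_ge0 => u uD; rewrite lee_fin mulr_ge0 ?powR_ge0//.
  by apply/ltW/phi0.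
have [N [N0 NE BE]] : exists N, [/\ 0 <= N, bergman_norm p phi f = N &
    bergman_integral p phi f = (N `^ p)%:E].
  exists (bergman_norm p phi f); split => //; first by rewrite powR_ge0.
  rewrite /bergman_norm -powRrM mulVf ?gt_eqF// powRr1 ?fine_ge0//.
  by rewrite fineK// ge0_fin_numE.
have [lambda hf] := analytic_power_series af.
have lambda_le n : (0 < n)%N -> cabs (lambda n) <= (K0 / A) `^ p^-1 * kappa n * N.
  move=> n0.
  have : cabs (lambda n) `^ p <= K0 / A * kappa n `^ p * N `^ p.
    rewrite -lee_fin.
    have := hA p phi lambda f n p1 rphi phi0 mprof hf.
    rewrite BE => H.
    have k0 : (0 <= (K0 / A * kappa n `^ p)%:E)%E.
      by rewrite lee_fin !mulr_ge0 ?powR_ge0 ?invr_ge0 ?(ltW A0) ?(ltW K00).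
    have {H} := lee_wpmul2l k0 H; rewrite -[X in (_ <= X)%E]EFinM.
    apply: le_trans; rewrite muleA -EFinM.
    have -> : K0 / A * kappa n `^ p * (A * cabs (lambda n) `^ p) =
       cabs (lambda n) `^ p * (K0 * kappa n `^ p) by field; rewrite gt_eqF.
    rewrite EFinM -muleA -[leLHS]mule1 lee_wpmul2l ?lee_fin ?powR_ge0//.
    exact: hmom.
  have : 0 <= K0 / A by rewrite mulr_ge0 ?invr_ge0 ?(ltW A0) ?(ltW K00).
  move: (K0 / A) => q q1 h; have q0 : 0 <= p^-1 by rewrite invr_ge0 ltW.
  have := ge0_ler_powR q0 _ _ h; rewrite !nnegrE powR_ge0.
  rewrite !mulr_ge0 ?powR_ge0// => /(_ isT isT).
  rewrite !powRM ?mulr_ge0 ?powR_ge0//.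
  by rewrite -!powRrM mulfV ?gt_eqF// !powRr1 ?cabs_ge0.
have sum_le (r : R) n : 0 < r < 1 ->
    profile phi r `^ p^-1 * \sum_(0 <= k < n) cabs (w k * lambda k) * r ^+ k <=
    c1 * N * (1 - r) `^ (- t).
  move=> r01; have /andP[r0 r1] := r01.
  have -> : c1 * N * (1 - r) `^ (- t) = (K0 / A) `^ p^-1 * N * (C * (1 - r) `^ (- t)).
    by rewrite /c1; ring.
  have k0 : 0 <= (K0 / A) `^ p^-1 * N by rewrite mulr_ge0 ?powR_ge0.
  apply: le_trans (ler_wpM2l k0 (hsum r n r01)).
  rewrite mulrCA ler_wpM2l ?powR_ge0// mulr_sumr; apply: ler_sum => k _.
  rewrite [leRHS]mulrA ler_wpM2r ?exprn_ge0 ?(ltW r0)// cabsM.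
  (* The coefficient bound is only available for positive indices; the constant term is killed by
     [w 0 = 0]. *)
  case: k => [|k]; first by rewrite w0 cabs0 !mul0r mulr0.
  rewrite mulrCA ler_wpM2l ?cabs_ge0// (le_trans (lambda_le _ _))//.
  by rewrite mulrAC.
have phir r : 0 < r < 1 -> 0 < profile phi r.
  move=> /andP[r0 r1]; apply: phi0.
  by rewrite /unit_disc /mkset cabsR ger0_norm ?ltW.
have bs (r : R) : 0 <= r < 1 -> bsum (fun k => cabs (w k * lambda k) * r ^+ k).
  (* Moving to a larger radius covers [r = 0], where the hypothesis gives nothing. *)
  move=> /andP[r0 r1]; pose r' := (r + 1) / 2.
  have r'01 : 0 < r' < 1 by rewrite /r'; lra.
  have rr' : r <= r' by rewrite /r'; lra.
  have q := powR_gt0 p^-1 (phir _ r'01).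
  exists ((profile phi r' `^ p^-1)^-1 * (c1 * N * (1 - r') `^ (- t))) => n.
  rewrite ler_pdivlMl//; apply: le_trans (sum_le r' n r'01).
  rewrite ler_wpM2l ?(ltW q)//; apply: ler_sum => k _.
  by rewrite ler_wpM2l ?cabs_ge0// lerXn2r ?nnegrE// (le_trans r0).
have /choice[g hg] : forall z : cplx R, exists l : cplx R, cabs z < 1 ->
    series (fun k => w k * lambda k * z ^+ k) @ \oo --> l.
  move=> z; have [z1|] := ltP (cabs z) 1; last by exists 0.
  have [|l hl] := @cseries_cvg R (fun k => w k * lambda k * z ^+ k); last by exists l.
  have z01 : 0 <= cabs z < 1 by rewrite cabs_ge0.
  by apply: (bsum_le _ (bs _ z01)) => k; rewrite cabsM cabsX.
have hgs : has_power_series 0 1 (fun n => w n * lambda n) g.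
  by move=> z; rewrite subr0 => z1; exact: hg.
have g_le z : cabs z < 1 ->
    cabs (g z) `^ p * phi z <= (c1 * N) `^ p * (1 - cabs z) `^ (- (t * p)).
  move=> z1; have c1N : 0 <= c1 * N by rewrite !mulr_ge0 ?powR_ge0 ?(ltW C0).
  (* At the origin, also outside the hypothesis, [g] vanishes because [w 0 = 0]. *)
  have := cabs_ge0 z; rewrite le_eqVlt => /predU1P[z0|z0].
    have -> : cabs (g z) = 0.
      apply/eqP; rewrite eq_le cabs_ge0 andbT.
      apply: (cabs_series_le (hg z z1)) => n.
      rewrite big1// => -[|k] _; first by rewrite w0 !mul0r cabs0.
      by rewrite cabsM cabsX -z0 expr0n mulr0.
    by rewrite powR0 ?gt_eqF// mul0r mulr_ge0 ?powR_ge0.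
  have z01 : 0 < cabs z < 1 by rewrite z0.
  have q := powR_gt0 p^-1 (phir _ z01).
  have h : profile phi (cabs z) `^ p^-1 * cabs (g z) <= c1 * N * (1 - cabs z) `^ (- t).
    rewrite -ler_pdivlMl//; apply: (cabs_series_le (hg z z1)) => n.
    rewrite ler_pdivlMl//; apply: le_trans (sum_le _ n z01).
    by rewrite ler_wpM2l ?(ltW q)//; apply: ler_sum => k _; rewrite cabsM cabsX.
  have := ge0_ler_powR (ltW p0) _ _ h; rewrite !nnegrE.
  rewrite (mulr_ge0 (ltW q)) ?cabs_ge0// mulr_ge0 ?powR_ge0// => /(_ isT isT).
  rewrite powRM ?cabs_ge0 ?(ltW q)// [leRHS]powRM ?powR_ge0// -!powRrM.
  rewrite mulVf ?gt_eqF// powRr1 ?(ltW (phir _ z01))// mulNr mulrC.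
  by rewrite /profile -rphi.
have g_an : analytic_on_disc g := power_series_analytic hgs.
have gB : (bergman_integral p phi g <= ((c1 * N) `^ p)%:E * I)%E.
  have mphi : measurable_fun D (fun u => phi (of_plane u) : RM).
    have /measurable_EFinP := mprof => /measurable_radial /measurable_EFinP.
    apply: eq_measurable_fun => u; rewrite inE => uD.
    by rewrite /profile -rphi.
  have mI : measurable_fun D (fun u => ((1 - cabs (of_plane u)) `^ (- (t * p)))%:E).
    apply/measurable_EFinP; apply: (measurableT_comp (measurable_powR _)).
    apply: measurable_funB; first exact: measurable_cst.
    by apply: measurable_funTS; exact: measurable_cabs_plane.
  have IE : (((c1 * N) `^ p)%:E * I = \int[@dA R]_(u in D)
      (((c1 * N) `^ p)%:E * ((1 - cabs (of_plane u)) `^ (- (t * p)))%:E))%E.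
    rewrite ge0_integralZl//; first exact: measurable_plane_disc.
      by move=> u _; rewrite lee_fin powR_ge0.
    by rewrite lee_fin powR_ge0.
  rewrite IE.
  apply: ge0_le_integral.
  - exact: measurable_plane_disc.
  - by move=> u uD; rewrite lee_fin mulr_ge0 ?powR_ge0//; exact/ltW/phi0.
  - apply/measurable_EFinP; apply: measurable_funM => //.
    apply: (measurableT_comp (measurable_powR p)).
    exact: (measurable_power_series hgs).
  - by apply: emeasurable_funM => //; exact: measurable_cst.
  - by move=> u uD; rewrite -EFinM lee_fin; exact: g_le.
have IE : I = (fine I)%:E by rewrite fineK// ge0_fin_numE.
have gBfin : (bergman_integral p phi g < +oo)%E.
  by apply: le_lt_trans gB _; rewrite IE -EFinM ltry.
have gB0 : (0 <= bergman_integral p phi g)%E.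
  apply: integral_ge0 => u uD; rewrite lee_fin mulr_ge0 ?powR_ge0//.
  by apply/ltW/phi0.
exists g; split => //; first by exists lambda.
have c10 : 0 <= c1 by rewrite mulr_ge0 ?powR_ge0 ?(ltW C0).
have q0 : 0 <= p^-1 by rewrite invr_ge0 ltW.
have h : fine (bergman_integral p phi g) <= (c1 * N) `^ p * fine I.
  by rewrite -lee_fin fineK ?ge0_fin_numE// EFinM -IE.
rewrite NE /bergman_norm; apply: le_trans (ge0_ler_powR q0 _ _ h) _.
- by rewrite nnegrE fine_ge0.
- by rewrite nnegrE mulr_ge0 ?powR_ge0 ?fine_ge0.
rewrite powRM ?powR_ge0 ?fine_ge0// -powRrM mulfV ?gt_eqF// powRr1 ?(mulr_ge0 c10 N0)//.
by rewrite mulrAC.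
Qed.

End criterion.

(** * Moments *)

Section moments.
Context {R : realType}.
Local Notation RM := (measurableTypeR R).
Local Notation mu := (@lebesgue_measure R).

Lemma partial_sum_le_eseries (a : nat -> R) (n : nat) : (forall k, 0 <= a k) ->
  a 0%N = 0 ->
  ((\sum_(0 <= k < n) a k)%:E <= \sum_(1 <= k <oo) (a k)%:E)%E.
Proof.
move=> a0 a00; case: n => [|n].
  by rewrite big_geq//; apply: nneseries_ge0 => k _ _; rewrite lee_fin.
rewrite big_ltn// a00 add0r -sumEFin.
by apply: nneseries_lim_ge => k _; rewrite lee_fin.
Qed.

(** The base is the inverse of [1 + 1/n], and [1 + 1/n <= exp (1/n)]. *)
Lemma onem_inv_pow_ge (n : nat) : (0 < n)%N ->
  expR (- 1) <= (1 - n.+1%:R^-1) ^+ n :> R.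
Proof.
move=> n0; have nR : 0 < n%:R :> R by rewrite ltr0n.
have h : expR (- n%:R^-1) <= 1 - n.+1%:R^-1 :> R.
  have -> : 1 - n.+1%:R^-1 = (1 + n%:R^-1)^-1 :> R.
    have n1 : 0 < n.+1%:R :> R by rewrite ltr0n.
    rewrite -[n.+1%:R]natr1 in n1 *.
    by field; rewrite ?gt_eqF//=; lra.
  rewrite expRN lef_pV2 ?posrE ?expR_gt0 ?addr_gt0 ?invr_gt0//.
  exact: expR_ge1Dx.
have -> : expR (- 1) = expR (- n%:R^-1) ^+ n :> R.
  by rewrite -expRM_natl mulrN mulfV// gt_eqF.
by rewrite lerXn2r// nnegrE ?expR_ge0// (le_trans (expR_ge0 _) h).
Qed.

(** On the interval [r ^+ n] is at least [exp (-1)] and the Jacobian [r] at least 1/2; the length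
    [1 / (2 (n + 1))] supplies the other 1/2. Stopping short of 1 keeps [1 - r] comparable to
    [1 / (n + 1)]. *)
Lemma moment_lower_bound (p v : R) (q : R -> R) (n : nat) : 1 <= p -> (0 < n)%N ->
  0 <= v -> measurable_fun (`[0, 1[%classic : set RM) q ->
  (forall r, 0 <= r < 1 -> 0 <= q r) ->
  (forall r, 1 - n.+1%:R^-1 <= r <= 1 - (2 * n.+1%:R)^-1 -> v <= q r) ->
  ((expR (- 1) `^ p / 4 * (v / n.+1%:R))%:E <=
   \int[mu]_(r in `[0%R, 1%R[) (r `^ (n%:R * p + 1) * q r)%:E)%E.
Proof.
move=> p1 n0 v0 mq q0 hq; have N0 : 0 < n.+1%:R :> R by rewrite ltr0n.
have p0 : 0 <= p by rewrite (le_trans ler01).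
have [x xE] : exists x : R, x = n.+1%:R^-1 by eexists.
have xh : x <= 2^-1 by rewrite xE lef_pV2 ?posrE// ler_nat.
have x0 : 0 < x by rewrite xE invr_gt0.
pose l : R := 1 - x; pose m : R := 1 - x / 2.
have {}hq r : l <= r <= m -> v <= q r.
  by move=> lrm; apply: hq; rewrite invfM -xE [2^-1 * x]mulrC.
have l2 : 2^-1 <= l by rewrite /l; lra.
have m1 : m < 1 by rewrite /m; lra.
have lm : l < m by rewrite /m /l; lra.
have sub : (`[l, m] : set RM) `<=` `[0, 1[.
  move=> r /=; rewrite !in_itv/= => /andP[lr rm]; apply/andP; split; lra.
have mf : measurable_fun (`[0, 1[%classic : set RM) (fun r => (r `^ (n%:R * p + 1) * q r)%:E).
  apply/measurable_EFinP; apply: measurable_funM => //.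
  by apply: measurable_funTS; exact: measurable_powR.
have f0 r : (`[0, 1[%classic : set RM) r -> (0 <= (r `^ (n%:R * p + 1) * q r)%:E)%E.
  by rewrite /= in_itv/= => r01; rewrite lee_fin mulr_ge0 ?powR_ge0 ?q0.
apply: (@le_trans _ _ (\int[mu]_(r in `[l, m]) (r `^ (n%:R * p + 1) * q r)%:E)%E); last first.
  exact: ge0_subset_integral.
apply: (@le_trans _ _ (\int[mu]_(r in `[l, m]) (cst (expR (- 1) `^ p / 2 * v)%:E r))%E).
  rewrite integral_cst//= lebesgue_measure_itv/= lte_fin lm -EFinD -EFinM lee_fin.
  by rewrite -xE le_eqVlt; apply/orP; left; apply/eqP; rewrite /m /l; field.
have c0 : 0 <= expR (- 1) `^ p / 2 * v by rewrite !mulr_ge0 ?powR_ge0.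
apply: ge0_le_integral => //.
- by apply: measurable_funS mf => //.
move=> r; rewrite /= in_itv/= => lrm; have /andP[lr rm] := lrm.
have r0 : 0 <= r by lra.
rewrite lee_fin -power_weight// ler_pM ?mulr_ge0 ?powR_ge0 ?hq//.
apply: ler_pM; rewrite ?powR_ge0//; last by lra.
apply: ge0_ler_powR => //; rewrite ?nnegrE ?expR_ge0 ?exprn_ge0//.
apply: le_trans (onem_inv_pow_ge n0) _; rewrite -xE -/l lerXn2r ?nnegrE//; lra.
Qed.

(** The interval is stable under inversion, which reduces negative exponents to positive ones;
    standard weights have exponents of both signs. *)
Lemma powR_norm_bounds (y e : R) : 2^-1 <= y <= 2 ->
  2 `^ (- `|e|) <= y `^ e <= 2 `^ `|e|.
Proof.
have key (x c : R) : 2^-1 <= x <= 2 -> 0 <= c -> 2 `^ (- c) <= x `^ c <= 2 `^ c.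
  move=> /andP[x1 x2] c0; apply/andP; split.
    have -> : 2 `^ (- c) = 2^-1 `^ c :> R by rewrite -[in RHS]powR_inv1// -powRrM mulN1r.
    by apply: ge0_ler_powR => //; rewrite nnegrE; lra.
  by apply: ge0_ler_powR => //; rewrite nnegrE; lra.
move=> y12; have /andP[y1 y2] := y12; have y0 : 0 < y by lra.
have [e0|e0] := leP 0 e; first by rewrite ger0_norm//; exact: key.
have y12' : 2^-1 <= y^-1 <= 2.
  by rewrite lef_pV2 ?posrE ?y2//= -[leRHS]invrK lef_pV2 ?posrE// invr_gt0.
have e0' : 0 <= - e by rewrite oppr_ge0 ltW.
rewrite ltr0_norm//; have := key _ _ y12' e0'.
have -> // : y^-1 `^ (- e) = y `^ e.
by rewrite -powR_inv1 ?ltW// -powRrM mulN1r opprK.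
Qed.

End moments.

(** * The three classes of weights *)

Section normal_and_standard_weights.
Context {R : realType}.
Local Notation RM := (measurableTypeR R).
Local Notation mu := (@lebesgue_measure R).
Local Notation D := (@plane_disc R : set (RM * RM)).

(** Finiteness: the power of [r] is at most [r], and [phi(r) r dr] is finite by polar coordinates.
    Positivity: a zero integral would make the positive integrand vanish almost everywhere on []0,
    1[]. *)
Lemma weight_moment (p : R) (phi : cplx R -> R) (n : nat) : 1 <= p ->
  weight phi -> radial phi ->
  measurable_fun (`[0, 1[%classic : set RM) (profile phi) ->
  0 < moment p phi n /\
  (\int[mu]_(r in `[0%R, 1%R[) (r `^ (n%:R * p + 1) * profile phi r)%:E
    = (moment p phi n)%:E)%E.
Proof.
move=> p1 [phi0 intphi] rphi mprof.
have mI : measurable (`[0%R, 1%R[%classic : set RM) by [].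
have prof_gt0 r : 0 <= r < 1 -> 0 < profile phi r.
  move=> /andP[r0 r1]; apply: phi0.
  by rewrite /unit_disc /mkset cabsR ger0_norm.
pose f (r : RM) : \bar R := (r `^ (n%:R * p + 1) * profile phi r)%:E.
have mf : measurable_fun (`[0%R, 1%R[%classic : set RM) f.
  apply/measurable_EFinP; apply: measurable_funM => //.
  by apply: measurable_funTS; exact: measurable_powR.
have f0 r : (`[0%R, 1%R[%classic : set RM) r -> (0 <= f r)%E.
  rewrite /= in_itv/= => r01.
  by rewrite lee_fin mulr_ge0 ?powR_ge0// ltW// prof_gt0.
have If0 : (0 <= \int[mu]_(r in `[0%R, 1%R[) f r)%E by exact: integral_ge0.
have f_lty : (\int[mu]_(r in `[0%R, 1%R[) f r < +oo)%E.
  have [A A0 hA] := @dA_polar R.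
  have mg : measurable_fun (`[0%R, 1%R[%classic : set RM) (fun r : RM => (profile phi r)%:E).
    exact/measurable_EFinP.
  have := hA _ mg (fun r hr => ltW (prof_gt0 r hr)).
  have -> : (\int[@dA R]_(u in D) (profile phi (cabs (of_plane u)))%:E
     = \int[@dA R]_(u in D) `|(phi (of_plane u))%:E|)%E.
    apply: eq_integral => u; rewrite inE => uD.
    by rewrite abse_EFin /profile -rphi// ger0_norm// ltW// phi0.
  have /integrableP[_ phi_lty] := intphi.
  move=> HA; move: phi_lty; rewrite HA => Hlty.
  apply: (@le_lt_trans _ _ (\int[mu]_(r in `[0%R, 1%R[) ((profile phi r)%:E * r%:E))%E).
    apply: ge0_le_integral => //.
    - apply: emeasurable_funM; first exact: mg.
      by apply/measurable_EFinP; exact: measurable_id.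
    move=> r; rewrite /= in_itv/= => r01; have /andP[r0 r1] := r01.
    rewrite -EFinM lee_fin mulrC ler_wpM2l ?(ltW (prof_gt0 _ r01))//.
    rewrite -power_weight// ler_piMl//; apply: (@le_trans _ _ (1 `^ p)); last by rewrite powR1.
    have p0 : 0 <= p := le_trans ler01 p1.
    apply: ge0_ler_powR => //; rewrite ?nnegrE ?exprn_ge0//.
    by rewrite exprn_ile1// ltW.
  rewrite ltNge leye_eq; apply/negP => /eqP E; move: Hlty.
  by rewrite E gt0_muley ?lte_fin// ltxx.
have ME : (\int[mu]_(r in `[0%R, 1%R[) f r = (moment p phi n)%:E)%E.
  by rewrite /moment /Rintegral fineK// ge0_fin_numE.
split; last exact: ME.
rewrite -lte_fin -ME lt_neqAle If0 andbT; apply/eqP => /esym f_eq0.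
have : (\int[mu]_(r in `[0%R, 1%R[) `|f r| = 0)%E.
  rewrite -[RHS]f_eq0; apply: eq_integral => r; rewrite inE => rI.
  by rewrite gee0_abs ?f0.
move=> /(ae_eq_integral_abs mu mI mf)[N [mN N0 subN]].
have : (mu `]0%R, 1%R[%classic <= mu N)%E.
  apply: le_measure; rewrite ?inE// => r /=; rewrite in_itv/= => /andP[r0 r1].
  apply: subN => /= h; have := h; rewrite in_itv/= (ltW r0) r1 => /(_ isT)/eqP.
  rewrite /f eqe mulf_eq0 => /orP[|]; rewrite gt_eqF//; first exact: powR_gt0.
  by rewrite prof_gt0// ltW.
rewrite N0 lebesgue_measure_itv/= lte_fin ltr01 oppr0 adde0.
by rewrite lee_fin ler10.
Qed.

Lemma normal_weight_multiplier (w : nat -> cplx R) (p : R) (phi : cplx R -> R) (C1 t : R) :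
  w 0%N = 0 -> 1 <= p -> normal_weight phi -> 0 < C1 -> t < 1 / p ->
  (forall r : R, 0 < r < 1 ->
    ((profile phi r `^ p^-1)%:E * Mtilde p phi w r <= (C1 / (1 - r) `^ t)%:E)%E) ->
  multiplier_bounded w p phi.
Proof.
move=> w0 p1 [wphi rphi cphi _] C10 tp h.
have p0 : 0 < p := lt_le_trans ltr01 p1.
have mprof : measurable_fun (`[0, 1[%classic : set RM) (profile phi).
  by apply: subspace_continuous_measurable_fun.
have M n := weight_moment n p1 wphi rphi mprof.
(* The [p]-th power of this [kappa n] is the inverse moment, so the moment condition is an equality
   with constant 1. *)
apply: (@multiplier_bounded_criterion R w p phi (fun n => moment p phi n `^ (- p^-1)) 1 C1 t) => //.
- by have [] := wphi.
- by move=> n; exact: powR_ge0.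
- move=> n n0; have [M0 ->] := M n.
  by rewrite mul1r -EFinM lee_fin -powRrM mulNr mulVf ?gt_eqF// powR_inv1 ?mulVf ?gt_eqF// ltW.
- by rewrite -div1r.
- move=> r n r01; have /andP[r0 r1] := r01.
  rewrite powRN -lee_fin; apply: le_trans (h r r01).
  rewrite EFinM lee_wpmul2l ?lee_fin ?powR_ge0//.
  apply: partial_sum_le_eseries; last by rewrite w0 cabs0 !mul0r.
  by move=> k; rewrite !mulr_ge0 ?cabs_ge0 ?powR_ge0 ?exprn_ge0 ?ltW.
Qed.

Lemma standard_weight_multiplier (w : nat -> cplx R) (p alpha C2 s : R) :
  w 0%N = 0 -> 1 <= p -> -1 < alpha -> 0 < C2 -> s < (alpha + 1) / p ->
  (forall r : R, 0 < r < 1 ->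
    (\sum_(1 <= n <oo)
       (cabs (w n) * n.+1%:R `^ ((alpha + 1) / p) * r ^+ n)%:E
       <= (C2 / (1 - r) `^ s)%:E)%E) ->
  multiplier_bounded w p (standard_weight alpha).
Proof.
move=> w0 p1 alpha1 C20 sp h.
have p0 : 0 < p := lt_le_trans ltr01 p1.
have a1 : 0 < 1 + alpha by lra.
have profE (r : R) : 0 <= r ->
    profile (standard_weight alpha) r = (1 + alpha) * (1 - r ^+ 2) `^ alpha.
  by move=> r0; rewrite /profile /standard_weight cabsR ger0_norm.
have mq : measurable_fun (`[0, 1[%classic : set RM) (profile (standard_weight alpha)).
  apply: (@eq_measurable_fun _ _ _ _ _ (fun r : RM => (1 + alpha) * (1 - r ^+ 2) `^ alpha : RM)).
    by move=> r; rewrite inE /= in_itv/= => /andP[r0 _]; rewrite profE.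
  apply: measurable_funTS; apply: measurable_funM => //.
  apply: (measurableT_comp (measurable_powR _)).
  by apply: measurable_funB => //; apply: measurable_funX.
have phi0 z : unit_disc z -> 0 < standard_weight alpha z.
  rewrite /unit_disc /mkset => z1; rewrite mulr_gt0// powR_gt0// subr_gt0.
  by rewrite exprn_ilt1// cabs_ge0.
have q0 (r : R) : 0 <= r < 1 -> 0 <= profile (standard_weight alpha) r.
  by move=> /andP[r0 r1]; apply/ltW/phi0; rewrite /unit_disc /mkset cabsR ger0_norm.
have [c [cE c0]] : exists c : R,
    c = expR (- 1) `^ p / 4 * ((1 + alpha) * 2 `^ (- `|alpha|)) /\ 0 < c.
  by eexists; split; first reflexivity; rewrite !mulr_gt0 ?powR_gt0 ?expR_gt0.
(* Since [1 + r] lies in [[1, 2]], the weight to the power [1/p] is at most [d] times [1 - r] to the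
   power [alpha / p]; hence the exponent [s - alpha / p] below. *)
pose d : R := ((1 + alpha) * 2 `^ `|alpha|) `^ p^-1.
have d0 : 0 < d by rewrite powR_gt0// mulr_gt0// powR_gt0.
apply: (@multiplier_bounded_criterion R w p _ (fun n => n.+1%:R `^ ((alpha + 1) / p))
  c^-1 (d * C2) (s - alpha / p)) => //.
- by move=> z z1; rewrite /standard_weight cabsR ger0_norm ?cabs_ge0.
- by rewrite invr_gt0.
- move=> n n0; have N0 : 0 < n.+1%:R :> R by rewrite ltr0n.
  pose v := (1 + alpha) * (2 `^ (- `|alpha|) * n.+1%:R `^ (- alpha)).
  have v0 : 0 <= v by rewrite !mulr_ge0 ?powR_ge0 ?ltW.
  have hv (r : R) : 1 - n.+1%:R^-1 <= r <= 1 - (2 * n.+1%:R)^-1 ->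
      v <= profile (standard_weight alpha) r.
    have : n.+1%:R^-1 <= 1 :> R by rewrite invf_le1// ler1n.
    have : 0 < n.+1%:R^-1 :> R by rewrite invr_gt0.
    rewrite invfM; have : n.+1%:R * n.+1%:R^-1 = 1 :> R by rewrite mulfV ?gt_eqF.
    rewrite /v; move: (n.+1%:R : R) N0 (n.+1%:R^-1 : R) => N NN0 x Nx x0 x1 /andP[r1 r2].
    rewrite profE; last by lra.
    (* Here [1 - r] is between [x / 2] and [x], and [1 + r] between 1 and 2, so the factor
       [N * (1 - r ^+ 2)] stays in [[1/2, 2]]. *)
    have -> : 1 - r ^+ 2 = (N * (1 - r ^+ 2)) * x by rewrite mulrC mulrA [x * N]mulrC Nx mul1r.
    have r1' : 0 <= 1 - r by lra.
    have y1 : 2^-1 <= N * (1 - r ^+ 2) <= 2.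
      have -> : 1 - r ^+ 2 = (1 - r) * (1 + r) by ring.
      apply/andP; split.
        have : 2^-1 * x <= (1 - r) * (1 + r).
          rewrite -[leLHS]mulr1; apply: ler_pM; lra.
        move=> /(ler_wpM2l (ltW NN0)); apply: le_trans.
        by rewrite mulrCA Nx mulr1.
      have : (1 - r) * (1 + r) <= x * 2 by apply: ler_pM; lra.
      by move=> /(ler_wpM2l (ltW NN0)); rewrite [X in _ <= X -> _]mulrA Nx mul1r.
    have /andP[b1 _] := powR_norm_bounds alpha y1.
    rewrite (powRM _ _ (ltW x0)); last by have /andP[y2 _] := y1; lra.
    rewrite ler_wpM2l ?(ltW a1)// ler_pM ?powR_ge0//.
    have -> : x = N^-1 by rewrite -[RHS]mulr1 -Nx mulKf// gt_eqF.
    by rewrite -(powR_inv1 (ltW NN0)) -powRrM mulN1r.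
  have H := moment_lower_bound p1 n0 v0 mq q0 hv.
  apply: (le_trans _ (lee_wpmul2l _ H)); last by rewrite lee_fin mulr_ge0 ?powR_ge0 ?invr_ge0 ?ltW.
  rewrite -EFinM lee_fin -powRrM divfK ?gt_eqF// le_eqVlt; apply/orP; left; apply/eqP.
  have -> : n.+1%:R `^ (alpha + 1) = n.+1%:R `^ alpha * n.+1%:R :> R.
    by rewrite powRD ?powRr1 ?ltW//; apply/implyP => _; rewrite gt_eqF.
  rewrite /v powRN; have := powR_gt0 alpha N0.
  have := c0; rewrite cE.
  move: (n.+1%:R `^ alpha) (n.+1%:R) N0 => y N NN0 cc0 y0.
  move: (expR (- 1) `^ p) (2 `^ (- `|alpha|)) (1 + alpha) a1 cc0 => e f g g0 cc0.
  have /andP[e0 f0] : (e != 0) && (f != 0).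
    by apply/andP; split; apply/eqP => E; move: cc0; rewrite E ?mul0r ?mulr0 ?ltxx.
  by field; rewrite ?e0 ?f0 ?gt_eqF.
- by rewrite ltrBlDl; move: sp; rewrite mulrDl mul1r.
- by rewrite mulr_gt0.
- move=> r n r01; have /andP[r0 r1] := r01; have r1' : 0 < 1 - r by rewrite subr_gt0.
  have S : \sum_(0 <= k < n) cabs (w k) * k.+1%:R `^ ((alpha + 1) / p) * r ^+ k <=
      C2 / (1 - r) `^ s.
    rewrite -lee_fin; apply: le_trans (h r r01).
    apply: partial_sum_le_eseries; last by rewrite w0 cabs0 !mul0r.
    by move=> k; rewrite !mulr_ge0 ?cabs_ge0 ?powR_ge0 ?exprn_ge0 ?ltW.
  have -> : d * C2 * (1 - r) `^ (- (s - alpha / p)) =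
      (d * (1 - r) `^ (alpha / p)) * (C2 / (1 - r) `^ s).
    rewrite opprB powRD; last by apply/implyP => _; rewrite gt_eqF.
    by rewrite powRN; ring.
  apply: ler_pM; [exact: powR_ge0| | |exact: S].
    by apply: sumr_ge0 => k _; rewrite !mulr_ge0 ?cabs_ge0 ?powR_ge0 ?exprn_ge0 ?(ltW r0).
  have b0 : 0 <= (1 + alpha) * 2 `^ `|alpha| by rewrite mulr_ge0 ?powR_ge0 ?(ltW a1).
  have p'0 : 0 <= p^-1 by rewrite invr_ge0 (ltW p0).
  rewrite /d (profE _ (ltW r0)) powRrM -(powRM _ b0 (powR_ge0 _ _)).
  apply: (ge0_ler_powR p'0).
  - by rewrite nnegrE mulr_ge0 ?powR_ge0 ?(ltW a1).
  - by rewrite nnegrE mulr_ge0 ?powR_ge0.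
  rewrite -mulrA ler_wpM2l ?(ltW a1)//.
  have -> : 1 - r ^+ 2 = (1 + r) * (1 - r) by ring.
  rewrite powRM ?(ltW r1')//; last by lra.
  rewrite ler_wpM2r ?powR_ge0//.
  by have /andP[_ ->] := @powR_norm_bounds R (1 + r) alpha ltac:(lra).
Qed.

End normal_and_standard_weights.

(** * Logarithmic weights *)

Section logarithmic_weight.
Context {R : realType}.
Local Notation RM := (measurableTypeR R).

Lemma log_weight_multiplier (w : nat -> cplx R) (p a b C3 u : R) :
  w 0%N = 0 -> 1 <= p -> 0 < b -> b < a -> 0 < C3 -> u < (a + 1 - b) / p ->
  (forall r : R, 0 < r < 1 ->
    (\sum_(1 <= n <oo)
       (cabs (w n) * (n.+1%:R `^ ((a + 1) / p) / ln n.+1%:R `^ (b / p)) * r ^+ n)%:E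
       <= (C3 / (1 - r) `^ u)%:E)%E) ->
  multiplier_bounded w p (log_weight a b).
Proof.
move=> w0 p1 b0 ba C30 up h.
have p0 : 0 < p := lt_le_trans ltr01 p1.
have a0 : 0 < a := lt_trans b0 ba.
have lnE (x : R) : 0 < x -> ln (expR 1 / x) = 1 - ln x.
  by move=> x0; rewrite ln_div ?posrE ?expR_gt0// expRK.
have profE (r : R) : 0 <= r < 1 ->
    profile (log_weight a b) r = (1 - r) `^ a * (1 - ln (1 - r)) `^ b.
  move=> /andP[r0 r1]; rewrite /profile /log_weight cabsR ger0_norm// lnE//.
  by rewrite subr_gt0.
have ln1_gt0 (x : R) : 0 < x <= 1 -> 0 < 1 - ln x.
  by move=> /andP[x0 x1]; have := ln_le0 x1; lra.
have mq : measurable_fun (`[0, 1[%classic : set RM) (profile (log_weight a b)).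
  apply: (@eq_measurable_fun _ _ _ _ _ (fun r : RM => (1 - r) `^ a * (1 - ln (1 - r)) `^ b : RM)).
    by move=> r; rewrite inE /= in_itv/= => r01; rewrite profE.
  have m1 : measurable_fun setT (fun r : RM => 1 - r : RM) by apply: measurable_funB.
  apply: measurable_funTS; apply: measurable_funM.
    exact: (measurableT_comp (measurable_powR _) m1).
  apply: (measurableT_comp (measurable_powR _)).
  apply: measurable_funB; first exact: measurable_cst.
  exact: (measurableT_comp (@measurable_ln R) m1).
have phi0 z : unit_disc z -> 0 < log_weight a b z.
  rewrite /unit_disc /mkset => z1; have z1' : 0 < 1 - cabs z by rewrite subr_gt0.
  rewrite /log_weight mulr_gt0 ?powR_gt0// lnE// ln1_gt0// z1'/=.
  by rewrite gerBl cabs_ge0.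
have q0 (r : R) : 0 <= r < 1 -> 0 <= profile (log_weight a b) r.
  by move=> /andP[r0 r1]; apply/ltW/phi0; rewrite /unit_disc /mkset cabsR ger0_norm.
have [c [cE c0]] : exists c : R, c = expR (- 1) `^ p / 4 * 2^-1 `^ a /\ 0 < c.
  eexists; split; first reflexivity.
  by rewrite !mulr_gt0 ?powR_gt0 ?expR_gt0.
have [kappa kappaE] : exists kappa : nat -> R,
  forall n, kappa n = n.+1%:R `^ ((a + 1) / p) / ln n.+1%:R `^ (b / p) by eexists.
have kappa0 n : 0 <= kappa n by rewrite kappaE divr_ge0 ?powR_ge0.
(* The weight is at most [1 - r] to the power [a - b], whence the exponent; the bound on [u] makes
   it smaller than [1/p]. *)
apply: (@multiplier_bounded_criterion R w p _ kappa c^-1 C3 (u - (a - b) / p)) => //.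
- by move=> z z1; rewrite /log_weight cabsR ger0_norm ?cabs_ge0.
- by rewrite invr_gt0.
- move=> n n0; have N0 : 0 < n.+1%:R :> R by rewrite ltr0n.
  have ln0 : 0 < ln n.+1%:R :> R by rewrite ln_gt0// ltr1n.
  pose v : R := (2^-1 `^ a * n.+1%:R `^ (- a)) * ln n.+1%:R `^ b.
  have v0 : 0 <= v by rewrite !mulr_ge0 ?powR_ge0.
  have hv (r : R) : 1 - n.+1%:R^-1 <= r <= 1 - (2 * n.+1%:R)^-1 ->
      v <= profile (log_weight a b) r.
    have : n.+1%:R^-1 <= 1 :> R by rewrite invf_le1// ler1n.
    have : 0 < n.+1%:R^-1 :> R by rewrite invr_gt0.
    have lnV' : ln n.+1%:R = - ln n.+1%:R^-1 :> R by rewrite lnV ?posrE// opprK.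
    rewrite invfM; move: ln0; rewrite /v lnV' => {lnV'}.
    rewrite powRN -(invrK n.+1%:R) -powRN.
    have -> : n.+1%:R^-1^-1 `^ (- a) = (n.+1%:R^-1) `^ a :> R.
      by rewrite -(@powR_inv1 _ n.+1%:R^-1) ?invr_ge0// -powRrM mulN1r opprK.
    rewrite invrK; move: (n.+1%:R^-1 : R) => x lnx x0 x1 /andP[r1 r2].
    have r01 : 0 <= r < 1 by apply/andP; split; lra.
    have y0 : 0 < 1 - r by lra.
    rewrite profE//; apply: ler_pM; rewrite ?mulr_ge0 ?powR_ge0//.
      have h2 : 0 <= 2^-1 :> R by [].
      rewrite -(powRM _ h2 (ltW x0)).
      by apply: ge0_ler_powR; rewrite ?nnegrE ?(ltW a0) ?(ltW y0) ?mulr_ge0 ?(ltW x0)//; lra.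
    (* From [1 - r <= x] the logarithmic factor is at least [1 - ln x], hence at least
       [- ln x = ln (n + 1)]. *)
    have lnle : ln (1 - r) <= ln x by rewrite ler_ln ?posrE//; lra.
    by apply: ge0_ler_powR; rewrite ?nnegrE ?(ltW b0) ?(ltW lnx)//; lra.
  have H := moment_lower_bound p1 n0 v0 mq q0 hv.
  have k0 : (0 <= (c^-1 * kappa n `^ p)%:E)%E.
    by rewrite lee_fin mulr_ge0 ?powR_ge0// invr_ge0 (ltW c0).
  apply: (le_trans _ (lee_wpmul2l k0 H)).
  rewrite -EFinM lee_fin kappaE powRM ?powR_ge0 ?invr_ge0 ?powR_ge0//.
  have -> : (ln n.+1%:R `^ (b / p))^-1 `^ p = (ln n.+1%:R `^ b)^-1 :> R.
    rewrite -powRN -powRrM mulNr divfK ?gt_eqF// powRN.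
    by [].
  rewrite -powRrM divfK ?gt_eqF// le_eqVlt; apply/orP; left; apply/eqP.
  have -> : n.+1%:R `^ (a + 1) = n.+1%:R `^ a * n.+1%:R :> R.
    by rewrite powRD ?powRr1 ?(ltW N0)//; apply/implyP => _; rewrite gt_eqF.
  rewrite /v powRN; have := powR_gt0 a N0; have := powR_gt0 b ln0.
  have := c0; rewrite cE.
  move: (n.+1%:R `^ a) (ln n.+1%:R `^ b) (n.+1%:R) N0 => y l N NN0 cc0 l0 y0.
  move: (expR (- 1) `^ p) (2^-1 `^ a) cc0 => e f cc0.
  have /andP[e0 f0] : (e != 0) && (f != 0).
    by apply/andP; split; apply/eqP => E; move: cc0; rewrite E ?mul0r ?mulr0 ?ltxx.
  by field; rewrite ?e0 ?f0 ?gt_eqF.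
- rewrite ltrBlDl; apply: (lt_le_trans up).
  by rewrite le_eqVlt; apply/orP; left; apply/eqP; ring.
- move=> r n r01; have /andP[r0 r1] := r01; have x0 : 0 < 1 - r by rewrite subr_gt0.
  have S : \sum_(0 <= k < n) cabs (w k) * kappa k * r ^+ k <= C3 / (1 - r) `^ u.
    rewrite -lee_fin; apply: le_trans (h r r01).
    under eq_eseriesr do rewrite -kappaE.
    apply: partial_sum_le_eseries; last by rewrite w0 cabs0 !mul0r.
    by move=> k; rewrite !mulr_ge0 ?cabs_ge0 ?exprn_ge0 ?(ltW r0).
  have -> : C3 * (1 - r) `^ (- (u - (a - b) / p)) =
      (1 - r) `^ ((a - b) / p) * (C3 / (1 - r) `^ u).
    rewrite opprB powRD; last by apply/implyP => _; rewrite gt_eqF.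
    by rewrite powRN; ring.
  apply: ler_pM; [exact: powR_ge0| | |exact: S].
    by apply: sumr_ge0 => k _; rewrite !mulr_ge0 ?cabs_ge0 ?exprn_ge0 ?(ltW r0).
  have p'0 : 0 <= p^-1 by rewrite invr_ge0 (ltW p0).
  rewrite powRrM; apply: (ge0_ler_powR p'0).
  - by rewrite nnegrE q0// (ltW r0).
  - by rewrite nnegrE powR_ge0.
  rewrite profE ?(ltW r0)//.
  have x1 : 1 - r <= 1 by rewrite gerBl (ltW r0).
  (* This is [ln y <= y - 1] at [y = (1 - r)^-1]. *)
  have lnx : 1 - ln (1 - r) <= (1 - r)^-1.
    have := @le_ln1Dx R ((1 - r)^-1 - 1); rewrite ltrBrDl addrN invr_gt0 x0.
    by rewrite addrC subrK lnV ?posrE// => /(_ isT); lra.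
  rewrite powRB; last by apply/implyP => _; rewrite gt_eqF.
  rewrite ler_wpM2l ?powR_ge0// -powRN.
  have -> : (1 - r) `^ (- b) = (1 - r)^-1 `^ b.
    by rewrite -(powR_inv1 (ltW x0)) -powRrM mulN1r.
  have l0 : 0 < 1 - ln (1 - r) by rewrite ln1_gt0// x0.
  by apply: ge0_ler_powR => //; rewrite ?nnegrE ?invr_ge0 ?(ltW b0) ?(ltW l0) ?(ltW x0).
Qed.

End logarithmic_weight.

Theorem theorem3p2 (R : realType) (w : nat -> cplx R) (p : R)
    (hw0 : w 0%N = 0) (hp : 1 <= p) :
  [/\ (forall phi : cplx R -> R, normal_weight phi ->
       forall C1 t : R, 0 < C1 -> t < 1 / p ->
       (forall r : R, 0 < r < 1 ->
          ((profile phi r `^ p^-1)%:E * Mtilde p phi w r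
             <= (C1 / (1 - r) `^ t)%:E)%E) ->
       multiplier_bounded w p phi),
      (forall alpha : R, -1 < alpha ->
       forall C2 s : R, 0 < C2 -> s < (alpha + 1) / p ->
       (forall r : R, 0 < r < 1 ->
          (\sum_(1 <= n <oo)
             (cabs (w n) * n.+1%:R `^ ((alpha + 1) / p) * r ^+ n)%:E
             <= (C2 / (1 - r) `^ s)%:E)%E) ->
       multiplier_bounded w p (standard_weight alpha)) &
      (forall a b : R, 0 < b -> b < a ->
       forall C3 u : R, 0 < C3 -> u < (a + 1 - b) / p ->
       (forall r : R, 0 < r < 1 ->
          (\sum_(1 <= n <oo)
             (cabs (w n) * (n.+1%:R `^ ((a + 1) / p) / ln n.+1%:R `^ (b / p))
                * r ^+ n)%:E
             <= (C3 / (1 - r) `^ u)%:E)%E) ->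
       multiplier_bounded w p (log_weight a b))].
Proof.
split.
- by move=> phi nphi C1 t C10 tp h; exact: normal_weight_multiplier C10 tp h.
- by move=> alpha a1 C2 s C20 sp h; exact: standard_weight_multiplier C20 sp h.
- by move=> a b b0 ba C3 u C30 up h; exact: log_weight_multiplier C30 up h.
Qed.
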